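(* Let $q\ge 4$ with $q\equiv 2$ or $4\pmod 6$. Then there exists a Steiner quadruple system on $B_q$ that satisfies the step property with respect to some total order on $B_q$.
   Context: $B_q=\{0,\dots,q-1\}$. A Steiner quadruple system $SQS(q)$ on $B_q$ is a set of 4-element subsets (quadruples) of $B_q$ such that every 3-element subset of $B_q$ is contained in exactly one quadruple. Step property: given a total order $L_0<L_1<\cdots<L_{q-1}$ on $B_q=\{L_0,\dots,L_{q-1}\}$ ($q$ even), the $SQS(q)$ satisfies the step property with respect to this order if for every $t\in\{0,\dots,q/2-1\}$ and every quadruple of the system of the form $\{L_{2t},L_{2t+1},L_a,L_b\}$, either $a<2t$ and $b<2t$, or $a>2t+1$ and $b>2t+1$. *)

(* Defs.v *)
From mathcomp Require Import all_boot all_fingroup.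
Set Implicit Arguments. Unset Strict Implicit. Unset Printing Implicit Defensive.

(* B_q is modelled as 'I_q = {0,...,q-1}. *)

Definition is_SQS (q : nat) (S : {set {set 'I_q}}) : Prop :=
  (forall Q, Q \in S -> #|Q| = 4) /\
  (forall T : {set 'I_q}, #|T| = 3 -> exists! Q, Q \in S /\ T \subset Q).

(* A total order L_0 < L_1 < ... < L_{q-1} on B_q is given by an enumeration
   L : {perm 'I_q}, with L_i := L i. *)
Definition step_property (q : nat) (S : {set {set 'I_q}}) (L : {perm 'I_q}) : Prop :=
  forall (t : nat) (Q : {set 'I_q}) (i j a b : 'I_q),
    t < q./2 -> val i = 2 * t -> val j = 2 * t + 1 ->
    Q \in S -> Q = [set L i; L j; L a; L b] ->
    #|Q| = 4 ->
    (a < 2 * t /\ b < 2 * t) \/ (2 * t + 1 < a /\ 2 * t + 1 < b).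

(* Main.v *)
(** A quadruple system is the same thing as a ternary operation [f] sending a triple to
    the fourth point of its block: [f] is symmetric, [f a a b = b] and [f a b] is an
    involution. Admissible orders are reached by recursion. Orders divisible by 4 are
    obtained by doubling. Orders 4(v-2)+2, 3(v-2)+2 and 3(v-4)+4 take copies of a system
    of order v that share their first one or two pairs (the stem), placed one after the
    other in the order; triples meeting two copies are completed by sum rules in Z_2n
    and one-factorizations. For a pair inside one copy the step property only forbids
    blocks whose other two points lie in an earlier and a later copy; in the tripling
    rules, pairs of antipodes avoid these. Orders 3(v-1)+1 and 12(v-1)+2 delete a point
    from a system of order v and inflate the other points by Z_3 and Z_12: blocks
    through the deleted point become an SQS(10), resp. a system on 3 * 12 + 2 points,
    and the remaining blocks become transversal designs. Together with an SQS(14) this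
    covers all residues modulo 72. *)

Require Import Defs.
From mathcomp Require Import all_boot all_algebra all_fingroup.
From mathcomp Require Import zify ring.

Set Implicit Arguments. Unset Strict Implicit. Unset Printing Implicit Defensive.

Import GRing.Theory.

Notation ternary T := (T -> T -> T -> T).

Definition skein (T : Type) (f : ternary T) : Prop :=
  [/\ forall a b c, f a b c = f b a c,
      forall a b c, f a b c = f a c b,
      forall a b, f a a b = b &
      forall a b c, f a b (f a b c) = c].

Definition step_pair (T : Type) (pos : T -> nat) (x y : T) : bool :=
  ~~ odd (pos x) && (pos y == (pos x).+1).

(* The condition for [pos c > pos y] follows, since [f x y] is an involution. *)
Definition stepped (T : Type) (pos : T -> nat) (f : ternary T) : Prop :=
  forall x y c, step_pair pos x y -> pos c < pos x -> pos (f x y c) < pos x.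

Definition step_order (v : nat) : Prop :=
  exists f : ternary 'I_v, skein f /\ stepped (@nat_of_ord v) f.

Section Transport.

Variables (T U : Type) (h : T -> U) (k : U -> T).
Hypotheses (hK : cancel h k) (kK : cancel k h).

Lemma skein_transport f : skein f -> skein (fun a b c => k (f (h a) (h b) (h c))).
Proof.
move=> [fC12 fC23 f12 fK]; split=> [a b c|a b c|a b|a b c] /=.
- by rewrite fC12.
- by rewrite fC23.
- by rewrite f12 hK.
- by rewrite kK fK hK.
Qed.

Lemma stepped_transport pos f : stepped pos f ->
  stepped (pos \o h) (fun a b c => k (f (h a) (h b) (h c))).
Proof. by move=> f_step x y c xy cx; rewrite /= kK; apply: f_step. Qed.

End Transport.

Section Numbering.

Implicit Types (T U S G W : finType).

Definition numbering T (pos : T -> nat) : Prop :=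
  injective pos /\ forall x, pos x < #|T|.

Lemma numbering_ord n : numbering (@nat_of_ord n).
Proof. by split=> [|x]; [exact: ord_inj | rewrite card_ord]. Qed.

Lemma numbering_bool : numbering nat_of_bool.
Proof. by split=> [[] []|[]] //; rewrite card_bool. Qed.

Lemma numbering_comp T U (pos : U -> nat) (h : T -> U) :
  injective h -> #|T| = #|U| -> numbering pos -> numbering (pos \o h).
Proof.
by move=> h_inj cardTU [pos_inj pos_lt]; split=> [|x /=]; [exact: inj_comp | rewrite cardTU].
Qed.

Lemma numbering_bij T (pos : T -> nat) : numbering pos ->
  exists h : T -> 'I_#|T|, bijective h /\ forall x, h x = pos x :> nat.
Proof.
case=> pos_inj pos_lt; exists (fun x => Ordinal (pos_lt x)); split=> //.
apply: inj_card_bij; last by rewrite card_ord.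
by move=> x y /(congr1 val) /= /pos_inj.
Qed.

Lemma numbering_surj T (pos : T -> nat) i : numbering pos -> i < #|T| -> exists x, pos x = i.
Proof.
move=> /numbering_bij[h [[k _ kK] hE]] i_lt.
by exists (k (Ordinal i_lt)); rewrite -hE kK.
Qed.

Lemma step_orderP T (pos : T -> nat) : numbering pos ->
  step_order #|T| <-> exists f, skein f /\ stepped pos f.
Proof.
move=> /numbering_bij[h [[k hK kK] hE]]; split=> -[f [fS f_step]].
  exists (fun a b c => k (f (h a) (h b) (h c))).
  split; first exact: (skein_transport hK kK fS).
  by move=> x y c; have /(_ x y c) := stepped_transport kK f_step; rewrite /step_pair /= !hE.
exists (fun a b c => h (f (k a) (k b) (k c))).
split; first exact: (skein_transport kK hK fS).
by move=> x y c; have /(_ x y c) := stepped_transport hK f_step; rewrite /step_pair /= -!hE !kK.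
Qed.

Definition option_pos (T : Type) (pos : T -> nat) (o : option T) : nat :=
  if o is Some x then (pos x).+1 else 0.

Lemma numbering_option T (pos : T -> nat) : numbering pos -> numbering (option_pos pos).
Proof.
case=> pos_inj pos_lt; rewrite /numbering card_option.
by split=> [|[x|] /=]; [move=> [x|] [y|] //= [/pos_inj->] | exact: pos_lt |].
Qed.

Definition sum_pos S G (posS : S -> nat) (posG : G -> nat) (p : S + G) : nat :=
  match p with inl s => posS s | inr g => #|S| + posG g end.

Definition lex_pos W G (posW : W -> nat) (posG : G -> nat) (p : W * G) : nat :=
  posW p.1 * #|G| + posG p.2.

Variables (S G W : finType) (posS : S -> nat) (posG : G -> nat) (posW : W -> nat).
Hypotheses (numS : numbering posS) (numG : numbering posG) (numW : numbering posW).

Let lex_pos_ltS w x v : posW w < v -> lex_pos posW posG (w, x) < v * #|G|.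
Proof.
move=> wv; apply: (@leq_trans ((posW w).+1 * #|G|)); last by rewrite leq_mul2r wv orbT.
by rewrite mulSnr ltn_add2l numG.2.
Qed.

Lemma ltn_lex_pos w x w' y :
  (lex_pos posW posG (w, x) < lex_pos posW posG (w', y)) =
  (posW w < posW w') || (w == w') && (posG x < posG y).
Proof.
rewrite -(inj_eq numW.1); case: (ltngtP (posW w) (posW w')) => [lt|gt|ww'] /=.
- by rewrite (leq_trans (lex_pos_ltS x lt)) ?leq_addr.
- by apply/negbTE; rewrite -leqNgt ltnW // (leq_trans (lex_pos_ltS y gt)) ?leq_addr.
- by rewrite /lex_pos /= ww' ltn_add2l.
Qed.

Lemma numbering_sum : numbering (sum_pos posS posG).
Proof.
rewrite /numbering card_sum; split.
  move=> [s|g] [t|k] /=.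
  - by move/numS.1->.
  - by move=> e; have := numS.2 s; rewrite e ltnNge leq_addr.
  - by move=> e; have := numS.2 t; rewrite -e ltnNge leq_addr.
  - by move/addnI/numG.1->.
by move=> [s|g] /=; [rewrite ltn_addr ?numS.2 | rewrite ltn_add2l numG.2].
Qed.

Lemma numbering_lex : numbering (lex_pos posW posG).
Proof.
rewrite /numbering card_prod; split=> [[w x] [w' y]|[w x]].
  move=> /(congr1 (edivn^~ #|G|)) /=; rewrite !edivn_eq ?numG.2 //.
  by case=> /numW.1-> /numG.1->.
exact: lex_pos_ltS (numW.2 w).
Qed.

Lemma step_pair_sum p q : ~~ odd #|S| ->
  step_pair (sum_pos posS posG) p q =
  match p, q with
  | inl s, inl t => step_pair posS s t
  | inr g, inr k => step_pair posG g k
  | _, _ => false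
  end.
Proof.
move=> evenS; rewrite /step_pair; case: p q => [s|g] [t|k] //=.
- by apply/negbTE; move: evenS (numS.2 s) => /=; lia.
- by apply/negbTE; move: evenS (numS.2 t) => /=; lia.
- by rewrite oddD (negbTE evenS) -addnS eqn_add2l.
Qed.

Lemma step_pair_lex w x w' y : ~~ odd #|G| ->
  step_pair (lex_pos posW posG) (w, x) (w', y) = (w == w') && step_pair posG x y.
Proof.
move=> evenG; rewrite /step_pair /lex_pos /= oddD oddM (negbTE evenG) andbF /=.
rewrite andbCA; case: (boolP (odd _)) => //= even_x.
have xG : (posG x).+1 < #|G| by move: evenG (numG.2 x) even_x => /=; lia.
apply/eqP/andP=> [/(congr1 (edivn^~ #|G|))|[/eqP-> /eqP->]]; last by rewrite addnS.
by rewrite -addnS !edivn_eq ?numG.2 // => -[/numW.1-> ->].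
Qed.

End Numbering.

Arguments lex_pos : simpl never.

(** * Skeins and quadruple systems *)

Definition block (T : Type) (f : ternary T) (a b c : T) : seq T := [:: a; b; c; f a b c].

Section SkeinTheory.

Variables (T : eqType) (f : ternary T).
Hypothesis fS : skein f.

Lemma skeinC12 a b c : f a b c = f b a c. Proof. by case: fS. Qed.
Lemma skeinC23 a b c : f a b c = f a c b. Proof. by case: fS. Qed.
Lemma skeinC13 a b c : f a b c = f c b a.
Proof. by rewrite skeinC12 skeinC23 skeinC12. Qed.
Lemma skein_same12 a b : f a a b = b. Proof. by case: fS. Qed.
Lemma skein_same13 a b : f a b a = b. Proof. by rewrite skeinC23 skein_same12. Qed.
Lemma skein_same23 a b : f b a a = b. Proof. by rewrite skeinC12 skein_same13. Qed.
Lemma skeinK a b c : f a b (f a b c) = c. Proof. by case: fS. Qed.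

Lemma skein_eq1 a b c : (f a b c == a) = (b == c).
Proof.
apply/eqP/eqP => [e|->]; last exact: skein_same23.
by rewrite -(skeinK a b c) e skein_same13.
Qed.
Lemma skein_eq2 a b c : (f a b c == b) = (a == c).
Proof. by rewrite skeinC12 skein_eq1. Qed.
Lemma skein_eq3 a b c : (f a b c == c) = (a == b).
Proof. by rewrite skeinC23 skein_eq2. Qed.

Lemma skein_perms x y z w : f x y z = w ->
  ((f x y z = w) * (f y x z = w) * (f x z y = w) *
   (f y z x = w) * (f z x y = w) * (f z y x = w))%type.
Proof.
move=> <-; do !split; rewrite ?(skeinC12 y x) //; first by rewrite skeinC23.
- by rewrite (skeinC23 y) (skeinC12 y).
- by rewrite (skeinC12 z) (skeinC23 x z).
- by rewrite (skeinC13 z).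
Qed.

Lemma skein_block x y z w : f x y z = w ->
  [/\ f x y w = z, f x z w = y & f y z w = x].
Proof.
move=> <-; split; first exact: skeinK.
  by rewrite (skeinC23 x y) skeinK.
by rewrite (skeinC12 x y) (skeinC23 y x) skeinK.
Qed.

Lemma block_uniq a b c : uniq (block f a b c) = uniq [:: a; b; c].
Proof.
rewrite -[block f a b c]/(rcons [:: a; b; c] (f a b c)) rcons_uniq !inE.
rewrite skein_eq1 skein_eq2 skein_eq3 /= !inE.
by case: (a == b); case: (a == c); case: (b == c).
Qed.

Lemma block_closed x y z : {in block f x y z & &, forall a b c, f a b c \in block f x y z}.
Proof.
rewrite /block; move xyz: (f x y z) => w.
have [xyw xzw yzw] := skein_block xyz.
have fE := (skein_perms xyz, skein_perms xyw, skein_perms xzw, skein_perms yzw).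
move=> a b c; rewrite !inE.
by do 3![case/or4P=> /eqP->]; rewrite ?fE ?skein_same12 ?skein_same13 ?skein_same23 ?eqxx ?orbT.
Qed.

End SkeinTheory.

Section QuadrupleSystem.

Variables (T : finType) (f : ternary T).
Hypothesis fS : skein f.

Definition blocks : {set {set T}} :=
  [set [set x in block f t.1.1 t.1.2 t.2] | t : T * T * T & uniq [:: t.1.1; t.1.2; t.2]].

Lemma blocksP (Q : {set T}) :
  reflect (exists a b c, uniq [:: a; b; c] /\ Q = [set x in block f a b c]) (Q \in blocks).
Proof.
apply: (iffP imsetP) => [[[[a b] c]]|[a [b [c [abc ->]]]]].
  by rewrite in_set => abc ->; exists a, b, c.
by exists (a, b, c); rewrite ?in_set.
Qed.

Lemma card_blocks Q : Q \in blocks -> #|Q| = 4.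
Proof.
case/blocksP=> a [b [c [abc ->]]]; rewrite cardsE.
by apply/card_uniqP; rewrite (block_uniq fS).
Qed.

Lemma blocks_eq Q a b c : Q \in blocks -> uniq [:: a; b; c] ->
  {subset [:: a; b; c] <= Q} -> Q = [set x in block f a b c].
Proof.
move=> QS abc sub; apply/esym/eqP; rewrite eqEcard (card_blocks QS).
rewrite [X in _ <= X]card_blocks ?andbT; last by apply/blocksP; exists a, b, c.
have fabc : f a b c \in Q.
  case/blocksP: QS sub => x [y [z [_ ->]]] sub.
  have in_block u : u \in [:: a; b; c] -> u \in block f x y z by move/sub; rewrite inE.
  by rewrite inE (block_closed fS) // in_block // !inE eqxx ?orbT.
apply/subsetP=> x; rewrite in_set !inE => /or4P[] /eqP-> //;
  by rewrite sub // !inE eqxx ?orbT.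
Qed.

End QuadrupleSystem.

Lemma blocks_is_SQS q (f : ternary 'I_q) : skein f -> is_SQS (blocks f).
Proof.
move=> fS; split=> [Q|T T3]; first exact: card_blocks.
have [a [b [c [abc TE]]]] : exists a b c, uniq [:: a; b; c] /\ T = [set x in [:: a; b; c]].
  have := enum_uniq T; have := set_enum T; move: T3; rewrite cardE.
  by case: (enum T) => [|a [|b [|c []]]] // _ <-; exists a, b, c.
exists [set x in block f a b c]; split.
  split; first by apply/blocksP; exists a, b, c.
  by rewrite TE; apply/subsetP=> x; rewrite !inE => /or3P[] ->; rewrite ?orbT.
move=> Q [QS /subsetP TQ]; apply/esym/blocks_eq => // x xT.
by rewrite TQ // TE inE.
Qed.

Lemma blocks_step_property q (f : ternary 'I_q) :
  skein f -> stepped (@nat_of_ord q) f -> step_property (blocks f) 1%g.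
Proof.
move=> fS f_step t Q i j a b _ it jt QS; rewrite !perm1 => QE Q4.
have {}QE : Q = [set x in [:: i; j; a; b]] by rewrite QE; apply/setP=> x; rewrite !inE -!orbA.
have ijab : uniq [:: i; j; a; b] by apply/card_uniqP; rewrite -cardsE -QE.
have ij : step_pair (@nat_of_ord q) i j by rewrite /step_pair it jt mul2n odd_double addn1 /=.
have below c d : uniq [:: i; j; c; d] -> c \in Q -> d \in Q -> c < 2 * t -> d < 2 * t.
  move=> ijcd cQ dQ; rewrite -it => ci.
  have : d \in block f i j c.
    rewrite -[_ \in _]in_set -(blocks_eq fS QS) //.
      by apply: subseq_uniq ijcd; apply: (prefix_subseq [:: i; j; c] [:: d]).
    by move=> x; rewrite !inE => /or3P[] /eqP-> //; rewrite QE !inE eqxx ?orbT.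
  rewrite !inE => /or4P[] /eqP dE; try by rewrite dE /= !inE eqxx ?orbT ?andbF in ijcd.
  by rewrite dE; apply: f_step.
have above c : i != c -> j != c -> 2 * t <= c -> 2 * t + 1 < c.
  by rewrite -!(inj_eq val_inj) it jt /=; lia.
have [aQ bQ] : a \in Q /\ b \in Q by rewrite QE !inE !eqxx !orbT.
have ijba : uniq [:: i; j; b; a].
  by rewrite -(@perm_uniq _ [:: i; j; a; b]) // !perm_cons (perm_catC [:: a] [:: b]).
have [[ia ja] [ib jb]] : (i != a /\ j != a) /\ (i != b /\ j != b).
  by move: ijab; rewrite /= !inE !negb_or => /and4P[/and3P[_ -> ->] /andP[-> ->]].
case: (ltnP a (2 * t)) => ta; [left|right]; first by split=> //; apply: (below a b).
split; apply: above => //; rewrite leqNgt; apply/negP => bt.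
by move: ta; rewrite leqNgt (below b a).
Qed.

(* For [m = 4], the block through the second pair and the first point lies below the
   second pair, so its fourth point is the second point. *)
Lemma stepped_closed (T : finType) (pos : T -> nat) (f : ternary T) m :
  numbering pos -> skein f -> stepped pos f -> (m == 2) || (m == 4) -> m <= #|T| ->
  {in [pred x | pos x < m] & &, forall a b c, pos (f a b c) < m}.
Proof.
move=> numT fS f_step m24 mT a b c; rewrite !inE => am bm cm.
case: (altP (a =P b)) => [->|ab]; first by rewrite (skein_same12 fS).
case: (altP (a =P c)) => [->|ac]; first by rewrite (skein_same13 fS).
case: (altP (b =P c)) => [->|bc]; first by rewrite (skein_same23 fS).
move: ab ac bc; rewrite -!(inj_eq numT.1) => ab ac bc.
case/orP: m24 => /eqP m_eq; first by exfalso; lia.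
subst m; have point i : i < 4 -> exists x, pos x = i.
  by move=> i4; apply: numbering_surj (leq_trans i4 mT).
have [[x0 p0] [x1 p1]] := (point 0 isT, point 1 isT).
have [[x2 p2] [x3 p3]] := (point 2 isT, point 3 isT).
have x1E : f x2 x3 x0 = x1.
  have low : pos (f x2 x3 x0) < 2 by rewrite -[X in _ < X]p2 f_step // ?/step_pair ?p0 ?p2 ?p3.
  have : f x2 x3 x0 != x0.
    by rewrite (skein_eq3 fS) -(inj_eq numT.1) p2 p3.
  by move=> ne; apply: numT.1; move: ne low; rewrite -(inj_eq numT.1) p0 p1; lia.
have in_block x : (pos x < 4) = (x \in block f x2 x3 x0).
  by rewrite /block x1E !inE -!(inj_eq numT.1) p0 p1 p2 p3; lia.
by rewrite in_block (block_closed fS) // -in_block.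
Qed.

Lemma stepped_sum_closed (S G : finType) (posS : S -> nat) (posG : G -> nat)
    (f : ternary (S + G)) :
  numbering posS -> numbering posG -> skein f -> stepped (sum_pos posS posG) f ->
  (#|S| == 2) || (#|S| == 4) ->
  forall r s t : S, exists u, f (inl r) (inl s) (inl t) = inl u.
Proof.
move=> numS numG fS f_step S24 r s t.
have := stepped_closed (numbering_sum numS numG) fS f_step S24.
rewrite card_sum leq_addr => /(_ isT (inl r) (inl s) (inl t)).
rewrite !inE /= !numS.2 => /(_ isT isT isT).
by case: (f _ _ _) => [u|g] /=; [exists u | rewrite ltnNge leq_addr].
Qed.

(** * One-factorizations *)

(* [g x y z] is the partner of [z] in the one-factor containing the edge [{x, y}]. *)
Definition one_factorization (T : Type) (g : ternary T) : Prop :=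
  [/\ forall x y z, g x y z = g y x z,
      forall x y, g x y x = y,
      forall x z, g x x z = z &
      forall x y z t, g z (g x y z) t = g x y t].

Section OneFactorizationTheory.

Variables (T : Type) (g : ternary T).
Hypothesis gO : one_factorization g.

Lemma ofacC x y z : g x y z = g y x z. Proof. by case: gO. Qed.
Lemma ofac_left x y : g x y x = y. Proof. by case: gO. Qed.
Lemma ofac_right x y : g x y y = x. Proof. by rewrite ofacC ofac_left. Qed.
Lemma ofac_same x z : g x x z = z. Proof. by case: gO. Qed.
Lemma ofac_edge x y z t : g z (g x y z) t = g x y t. Proof. by case: gO. Qed.
Lemma ofacK x y z : g x y (g x y z) = z.
Proof. by rewrite -(ofac_edge x y z (g x y z)) ofac_right. Qed.

End OneFactorizationTheory.

Lemma one_factorization_transport (T U : Type) (h : T -> U) (k : U -> T) g :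
  cancel h k -> cancel k h -> one_factorization g ->
  one_factorization (fun a b c => k (g (h a) (h b) (h c))).
Proof.
move=> hK kK gO; split=> [x y z|x y|x z|x y z t] /=.
- by rewrite ofacC.
- by rewrite ofac_left.
- by rewrite ofac_same.
- by rewrite kK ofac_edge.
Qed.

Section EdgeColouring.

Variables (T : eqType) (C : Type) (colour : T -> T -> C) (partner : C -> T -> T).
Hypothesis colourC : forall x y, x != y -> colour x y = colour y x.
Hypothesis partner_colour : forall x y, x != y -> partner (colour x y) x = y.
Hypothesis colour_partner : forall x y z, x != y ->
  z != partner (colour x y) z /\ colour z (partner (colour x y) z) = colour x y.

Definition colouring_partner (x y z : T) : T := if x == y then z else partner (colour x y) z.

Lemma colouring_one_factorization : one_factorization colouring_partner.
Proof.
rewrite /colouring_partner; split=> [x y z|x y|x z|x y z t].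
- by rewrite eq_sym; case: (altP (y =P x)) => // yx; rewrite (colourC yx).
- by case: (altP (x =P y)) => // xy; rewrite partner_colour.
- by rewrite eqxx.
- case: (altP (x =P y)) => [_|xy]; first by rewrite eqxx.
  by have [/negbTE-> ->] := colour_partner z xy.
Qed.

End EdgeColouring.

Section CyclicOneFactorization.

Local Open Scope ring_scope.

Variable j : nat.
Let Z := 'I_j.*2.+1.

Let half (x : Z) : Z := x *+ j.+1.

Let halfK x : half x + half x = x.
Proof.
rewrite /half -mulrnDr addnn doubleS Zp_mulrn; apply/val_inj => /=.
by rewrite mulnC mulSn -mulnC addnC modnMDl modn_small.
Qed.

Let double_inj (x y : Z) : x + x = y + y -> x = y.
Proof.
have doubleK (z : Z) : half (z + z) = z by rewrite -[RHS]halfK /half mulrnDl.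
by move=> e; rewrite -(doubleK x) e doubleK.
Qed.

Let colour (x y : option Z) : Z :=
  match x, y with
  | Some a, Some b => a + b
  | Some a, None | None, Some a => a + a
  | None, None => 0
  end.

Let partner (c : Z) (z : option Z) : option Z :=
  if z is Some a then if c - a == a then None else Some (c - a) else Some (half c).

Lemma cyclic_one_factorization : exists g : ternary (option Z), one_factorization g.
Proof.
exists (colouring_partner colour partner).
apply: colouring_one_factorization => [[a|] [b|] _|[a|] [b|] //= ab|x y z _] //=.
- exact: addrC.
- by rewrite [a + b]addrC addrK; case: (b =P a) ab => // ->; rewrite eqxx.
- by rewrite addrK eqxx.
- by congr Some; apply: double_inj; rewrite halfK.
case: z => [a|] /=; last by rewrite halfK.
case: (colour x y - a =P a) => [ca|ne] /=; split=> //.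
- by rewrite -{1}ca subrK.
- by apply/eqP=> -[/esym].
- by rewrite addrC subrK.
Qed.

End CyclicOneFactorization.

Lemma one_factorization_exists (T : finType) :
  ~~ odd #|T| -> exists g : ternary T, one_factorization g.
Proof.
case: (posnP #|T|) => [T0 _|Tpos ev].
  by exists (fun _ _ z => z); split=> x; have := fintype0 x; rewrite T0 => /(_ erefl).
have [j Tj] : exists j, #|T| = #|{: option 'I_j.*2.+1}|.
  by exists (#|T|.-1)./2; rewrite card_option card_ord; lia.
have [g gO] := cyclic_one_factorization j.
have [h [k hK kK]] : exists h : T -> option 'I_j.*2.+1, bijective h.
  exists (fun x => enum_val (cast_ord Tj (enum_rank x))).
  by apply: inj_card_bij; [move=> x y /enum_val_inj/cast_ord_inj/enum_rank_inj | rewrite Tj].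
eexists; exact: (one_factorization_transport hK kK gO).
Qed.

Section Doubling.

Variables (T : eqType) (f g : ternary T).
Hypotheses (fS : skein f) (gO : one_factorization g).

Definition doubling (p q r : T * bool) : T * bool :=
  if p.2 == q.2 then
    if q.2 == r.2 then (f p.1 q.1 r.1, r.2) else (g p.1 q.1 r.1, r.2)
  else if p.2 == r.2 then (g p.1 r.1 q.1, q.2) else (g q.1 r.1 p.1, p.2).

Lemma doubling_skein : skein doubling.
Proof.
split=> [[x a] [y b] [z c]|[x a] [y b] [z c]|[x a] [y b]|[x a] [y b] [z c]]; rewrite /doubling /=.
- by case: a b c => [] [] [] /=; congr pair;
    by [apply: skeinC12 fS _ _ _|apply: ofacC gO _ _ _|].
- by case: a b c => [] [] [] /=; congr pair;
    by [apply: skeinC23 fS _ _ _|apply: ofacC gO _ _ _|].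
- by case: a b => [] [] /=; rewrite ?(skein_same12 fS) ?(ofac_same gO).
- by case: a b c => [] [] [] /=; rewrite ?(skeinK fS) ?(ofacK gO) ?(ofac_edge gO)
    ?(ofac_left gO) ?(ofac_right gO).
Qed.

End Doubling.

Theorem step_order_double v : ~~ odd v -> step_order v -> step_order v.*2.
Proof.
move=> even_v [f [fS _]].
have [g gO] : exists g : ternary 'I_v, one_factorization g.
  by apply: one_factorization_exists; rewrite card_ord.
have -> : v.*2 = #|{: 'I_v * bool}| by rewrite card_prod card_ord card_bool muln2.
apply/(step_orderP (numbering_lex numbering_bool (numbering_ord v))).
exists (doubling f g); split; first exact: doubling_skein.
move=> [x a] [y b] [z c].
rewrite (step_pair_lex numbering_bool (numbering_ord v)) ?card_bool // => /andP[/eqP <-].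
rewrite /doubling !(ltn_lex_pos numbering_bool (numbering_ord v)).
by case: a b c => [] [] [] //= _; rewrite (ofac_left gO) andbF orbF => ->.
Qed.

(** * Candelabra systems *)

(* Points of a candelabra: a stem [S] and, for each index in [W], a copy of the group [G]. *)
Notation candelabra_point S G W := (S + W * G)%type (only parsing).

Section Candelabra.

Variables (S G W : eqType).

Local Notation point := (candelabra_point S G W).
Implicit Types (a b c : point) (w : W) (p q r : S + G).

Definition apart a b : bool :=
  match a, b with inr p, inr q => p.1 != q.1 | _, _ => false end.

Definition crossing a b c : bool := [|| apart a b, apart a c | apart b c].

(* A candelabra quadruple system, given by the fourth point of the block through a
   triple that meets two different groups. *)
Definition candelabra (h : ternary point) : Prop :=
  [/\ forall a b c, crossing a b c -> h a b c = h b a c,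
      forall a b c, crossing a b c -> h a b c = h a c b,
      forall a b, apart a b -> h a a b = b &
      forall a b c, crossing a b c -> crossing a b (h a b c) /\ h a b (h a b c) = c].

Lemma apartC a b : apart a b = apart b a.
Proof. by case: a b => [s|[x g]] [t|[y k]] //=; rewrite eq_sym. Qed.

Lemma apartxx a : apart a a = false.
Proof. by case: a => [s|[x g]] //=; rewrite eqxx. Qed.

Lemma crossingC12 a b c : crossing a b c = crossing b a c.
Proof. by rewrite /crossing (apartC a b) [apart a c || _]orbC. Qed.

Lemma crossingC23 a b c : crossing a b c = crossing a c b.
Proof. by rewrite /crossing (apartC b c) orbCA. Qed.

Definition to_group w p : point := match p with inl s => inl s | inr g => inr (w, g) end.

Definition forget a : S + G := match a with inl s => inl s | inr p => inr p.2 end.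

Definition group_index a : option W := if a is inr p then Some p.1 else None.

Lemma to_groupK w : cancel (to_group w) forget.
Proof. by case. Qed.

Lemma crossing_to_group w p q r :
  crossing (to_group w p) (to_group w q) (to_group w r) = false.
Proof. by rewrite /crossing; case: p q r => [?|?] [?|?] [?|?] /=; rewrite ?eqxx. Qed.

Lemma ncrossingP (w0 : W) a b c : ~~ crossing a b c ->
  exists w p q r, [/\ a = to_group w p, b = to_group w q & c = to_group w r].
Proof.
move=> nc; exists (odflt w0 (ohead (pmap group_index [:: a; b; c]))).
exists (forget a), (forget b), (forget c); move: nc.
by case: a b c => [s|[x g]] [t|[y k]] [u|[z l]] //=;
   rewrite /crossing ?negb_or //= ?negbK ?(orbF, andbT) => e;
   (try case/and3P: e => e e' _); (try move: e e' => /eqP-> /eqP->); (try move: e => /eqP->).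
Qed.

Section Fill.

Variables (h : ternary point) (f : ternary (S + G)) (w0 : W).
Hypotheses (hC : candelabra h) (fS : skein f).
Hypothesis stem_closed : forall r s t : S, exists u, f (inl r) (inl s) (inl t) = inl u.

Definition fill a b c : point :=
  if crossing a b c then h a b c else
  to_group (odflt w0 (ohead (pmap group_index [:: a; b; c])))
    (f (forget a) (forget b) (forget c)).

Lemma fill_to_group w p q r :
  fill (to_group w p) (to_group w q) (to_group w r) = to_group w (f p q r).
Proof.
rewrite /fill crossing_to_group !to_groupK.
case: p q r => [s|g] [t|k] [u|l] //=.
by have [x ->] := stem_closed s t u.
Qed.

Lemma fill_crossing a b c : crossing a b c -> fill a b c = h a b c.
Proof. by rewrite /fill => ->. Qed.

Lemma fill_skein : skein fill.
Proof.
have [hC12 hC23 h12 hK] := hC.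
split=> [a b c|a b c|a b|a b c].
- case: (boolP (crossing a b c)) => [cr|/(ncrossingP w0)[w [p [q [r [-> -> ->]]]]]].
    by rewrite (fill_crossing cr) hC12 // fill_crossing // -crossingC12.
  by rewrite !fill_to_group (skeinC12 fS).
- case: (boolP (crossing a b c)) => [cr|/(ncrossingP w0)[w [p [q [r [-> -> ->]]]]]].
    by rewrite (fill_crossing cr) hC23 // fill_crossing // -crossingC23.
  by rewrite !fill_to_group (skeinC23 fS).
- case: (boolP (crossing a a b)) => [cr|/(ncrossingP w0)[w [p [_ [r [-> _ ->]]]]]].
    by rewrite fill_crossing // h12 //; move: cr; rewrite /crossing apartxx /= orbb.
  by rewrite !fill_to_group (skein_same12 fS).
- case: (boolP (crossing a b c)) => [cr|/(ncrossingP w0)[w [p [q [r [-> -> ->]]]]]].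
    by have [cr' abd] := hK _ _ _ cr; rewrite (fill_crossing cr) fill_crossing.
  by rewrite !fill_to_group (skeinK fS).
Qed.

End Fill.

Definition stepped_candelabra (posG : G -> nat) (posW : W -> nat) (h : ternary point) : Prop :=
  forall w x y z, step_pair posG x y -> posW z.1 < posW w ->
    exists2 t, h (inr (w, x)) (inr (w, y)) (inr z) = inr t & posW t.1 < posW w.

End Candelabra.

Section FilledOrder.

Variables (S G W : finType) (posS : S -> nat) (posG : G -> nat) (posW : W -> nat).
Hypotheses (numS : numbering posS) (numG : numbering posG) (numW : numbering posW).
Hypotheses (evenS : ~~ odd #|S|) (evenG : ~~ odd #|G|).

Let pos : candelabra_point S G W -> nat := sum_pos posS (lex_pos posW posG).

Let ltn_pos_to_group w p q :
  (pos (to_group w p) < pos (to_group w q)) = (sum_pos posS posG p < sum_pos posS posG q).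
Proof.
rewrite /pos; case: p q => [s|g] [t|k] //=.
- by rewrite !ltn_addr ?numS.2.
- by rewrite ltnNge [RHS]ltnNge !(leq_trans (ltnW (numS.2 t))) ?leq_addr.
- by rewrite ltn_add2l (ltn_lex_pos numG numW) ltnn eqxx ltn_add2l.
Qed.

Lemma fill_stepped (h : ternary (candelabra_point S G W)) (f : ternary (S + G)) (w0 : W) :
  stepped_candelabra posG posW h -> stepped (sum_pos posS posG) f ->
  (forall r s t : S, exists u, f (inl r) (inl s) (inl t) = inl u) ->
  stepped pos (fill h f w0).
Proof.
move=> h_step f_step closed.
have in_group w p q r : step_pair (sum_pos posS posG) p q ->
    pos (to_group w r) < pos (to_group w p) ->
    pos (fill h f w0 (to_group w p) (to_group w q) (to_group w r)) < pos (to_group w p).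
  by move=> pq; rewrite fill_to_group // !ltn_pos_to_group; apply: f_step.
move=> a b c; rewrite (step_pair_sum _ numS) // -/pos.
case: a b => [s|[w x]] [t|[w' y]] // ab c_lt.
  case: c c_lt => [u|[w x]] c_lt; last first.
    by move: (ltn_trans c_lt (numS.2 s)); rewrite ltnNge leq_addr.
  by apply: (in_group w0 (inl s) (inl t) (inl u)) => //; rewrite (step_pair_sum _ numS).
move: ab; rewrite (step_pair_lex numG numW) // => /andP[/eqP <- xy].
have xy_pair : step_pair (sum_pos posS posG) (inr x) (inr y) by rewrite (step_pair_sum _ numS).
case: c c_lt => [u|[w'' z]]; first exact: (in_group w (inr x) (inr y) (inl u)).
case: (altP (w'' =P w)) => [->|ww'']; first exact: (in_group w (inr x) (inr y) (inr z)).
rewrite /pos /= ltn_add2l (ltn_lex_pos numG numW) (negbTE ww'') orbF => /= w''w.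
rewrite fill_crossing; last by rewrite /crossing /= eqxx eq_sym ww''.
have [[v u] -> /= vw] := h_step w x y (w'', z) xy w''w.
by rewrite ltn_add2l (ltn_lex_pos numG numW) vw.
Qed.

End FilledOrder.

Theorem step_order_fill (S G W : finType) (posS : S -> nat) (posG : G -> nat) (posW : W -> nat)
    (h : ternary (candelabra_point S G W)) :
  numbering posS -> numbering posG -> numbering posW ->
  (#|S| == 2) || (#|S| == 4) -> ~~ odd #|G| -> 0 < #|W| ->
  candelabra h -> stepped_candelabra posG posW h ->
  step_order (#|S| + #|G|) -> step_order (#|S| + #|W| * #|G|).
Proof.
move=> numS numG numW S24 evenG /card_gt0P[w0 _] hC h_step.
have evenS : ~~ odd #|S| by case/orP: S24 => /eqP->.
rewrite -card_sum => /(step_orderP (numbering_sum numS numG))[f [fS f_step]].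
have closed := stepped_sum_closed numS numG fS f_step S24.
rewrite -card_prod -card_sum.
apply/(step_orderP (numbering_sum numS (numbering_lex numG numW))).
by exists (fill h f w0); split; [exact: fill_skein | exact: fill_stepped].
Qed.

Section CandelabraCriterion.

Variables (S G W : eqType).

Local Notation point := (candelabra_point S G W).
Implicit Types a b c : point.

Lemma crossing_apart12 a b c : apart a b -> crossing a b c.
Proof. by rewrite /crossing => ->. Qed.

Lemma crossing_apart23 a b c : apart b c -> crossing a b c.
Proof. by rewrite /crossing => ->; rewrite !orbT. Qed.

Section Involution.

Variable h : ternary point.
Hypothesis hC12 : forall a b c, crossing a b c -> h a b c = h b a c.
Hypothesis hC23 : forall a b c, crossing a b c -> h a b c = h a c b.
Hypothesis h12 : forall a b, apart a b -> h a a b = b.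
Hypothesis h_apartK : forall a b c, apart a b -> h a b (h a b c) = c.
Hypothesis h_crossing :
  forall a b c, ~~ apart a b -> crossing a b c -> crossing a b (h a b c).

(* If [{a, b, c, d}] is a block with [b] apart from [c] and [d], its three points
   [b], [c], [d] determine [a] and then [b], [d], [a] determine [c]. *)
Let involution_of_apart a b c : apart b c -> apart b (h a b c) -> h a b (h a b c) = c.
Proof.
move=> bc; set d := h a b c => bd.
have dE : d = h b c a.
  by rewrite /d hC12 ?crossing_apart23 // hC23 // -crossingC12 crossing_apart23.
have bcd : h b c d = a by rewrite dE h_apartK.
rewrite hC12 ?crossing_apart23 // hC23; last by rewrite -crossingC12 crossing_apart23.
by rewrite -[X in h b d X]bcd [h b c d]hC23 ?crossing_apart12 // h_apartK.
Qed.

Lemma candelabra_of_apart : candelabra h.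
Proof.
split=> // a b c cr; case: (boolP (apart a b)) => [ab|nab].
  by split; [exact: crossing_apart12 | exact: h_apartK].
have cr' := h_crossing nab cr; split=> //.
have [bP|aP] : (forall d, crossing a b d -> apart b d) \/ (forall d, crossing a b d -> apart a d).
- case: a b nab {cr cr'} => [s|[i x]] [t|[j y]] //= ij; [by left; case | by left; case | |].
    by right=> d; rewrite /crossing /= orbF.
  by left=> d; rewrite /crossing /= (negbTE ij) (eqP (negbNE ij)) /= orbb.
- by apply: involution_of_apart; apply: bP.
rewrite hC12 // [h a b c]hC12 // involution_of_apart // -?[h b a c]hC12 //; exact: aP.
Qed.

End Involution.

Section Assembly.

Variables (stem : S -> W * G -> W * G -> point) (aligned : W -> G -> G -> W * G -> point).
Variable transversal : W * G -> W * G -> W * G -> point.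

Implicit Types (s : S) (i : W) (x y z : G) (p q r : W * G).

Definition assemble a b c : point :=
  match a, b, c with
  | inr p, inr q, inr r =>
    if p.1 == q.1 then aligned p.1 p.2 q.2 r else
    if p.1 == r.1 then aligned p.1 p.2 r.2 q else
    if q.1 == r.1 then aligned q.1 q.2 r.2 p else transversal p q r
  | inl s, inr p, inr q | inr p, inl s, inr q | inr p, inr q, inl s => stem s p q
  | _, _, _ => a
  end.

Definition in_distinct_groups p q r : bool := [&& p.1 != q.1, p.1 != r.1 & q.1 != r.1].

Hypothesis stemC : forall s p q, p.1 != q.1 -> stem s p q = stem s q p.
Hypothesis alignedC : forall i x y r, i != r.1 -> aligned i x y r = aligned i y x r.
Hypothesis transversalC12 : forall p q r,
  in_distinct_groups p q r -> transversal p q r = transversal q p r.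
Hypothesis transversalC23 : forall p q r,
  in_distinct_groups p q r -> transversal p q r = transversal p r q.
Hypothesis aligned_same : forall i x r, i != r.1 -> aligned i x x r = inr r.
Hypothesis stemK : forall s p q, p.1 != q.1 -> assemble (inr p) (inr q) (stem s p q) = inl s.
Hypothesis alignedK : forall p z q, p.1 != q.1 ->
  assemble (inr p) (inr q) (aligned p.1 p.2 z q) = inr (p.1, z).
Hypothesis transversalK : forall p q r,
  in_distinct_groups p q r -> assemble (inr p) (inr q) (transversal p q r) = inr r.
Hypothesis stem_apart : forall s p q, p.1 != q.1 -> apart (inr p) (stem s p q).
Hypothesis aligned_apart : forall i x y r, i != r.1 -> apart (inr (i, x)) (aligned i x y r).

Lemma assembleC12 a b c : crossing a b c -> assemble a b c = assemble b a c.
Proof.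
case: a b c => [s|p] [t|q] [u|r] //; rewrite /crossing /= ?orbF //; first exact: stemC.
rewrite [q.1 == p.1]eq_sym; case: (altP (p.1 =P q.1)) => [-> /= |pq _].
  by rewrite orbb => qr; rewrite alignedC.
case: (altP (p.1 =P r.1)) => [<-|pr]; first by rewrite [q.1 == _]eq_sym (negbTE pq).
case: (altP (q.1 =P r.1)) => // qr.
by rewrite transversalC12 // /in_distinct_groups pq pr.
Qed.

Lemma assembleC23 a b c : crossing a b c -> assemble a b c = assemble a c b.
Proof.
case: a b c => [s|p] [t|q] [u|r] //; rewrite /crossing /= ?orbF //; first exact: stemC.
case: (altP (p.1 =P q.1)) => [<- /=|pq _]; first by rewrite orbb => /negbTE->.
case: (altP (p.1 =P r.1)) => // pr; rewrite [r.1 == q.1]eq_sym.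
case: (altP (q.1 =P r.1)) => [qr|qr]; first by rewrite -qr alignedC // eq_sym.
by rewrite transversalC23 // /in_distinct_groups pq pr.
Qed.

Lemma assemble_apartK a b c : apart a b -> assemble a b (assemble a b c) = c.
Proof.
case: a b => [s|p] [t|q] // pq; rewrite /apart in pq.
case: c => [u|r]; first exact: stemK.
rewrite [X in assemble _ _ X]/assemble (negbTE pq).
case: (altP (p.1 =P r.1)) => [pr|pr]; first by rewrite alignedK // pr -surjective_pairing.
case: (altP (q.1 =P r.1)) => [qr|qr]; last by rewrite transversalK // /in_distinct_groups pq pr.
rewrite assembleC12; last by rewrite crossing_apart12.
by rewrite alignedK 1?eq_sym // qr -surjective_pairing.
Qed.

Lemma assemble_candelabra : candelabra assemble.
Proof.
apply: candelabra_of_apart.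
- exact: assembleC12.
- exact: assembleC23.
- by move=> [s|p] [t|q] //= pq; rewrite eqxx aligned_same.
- exact: assemble_apartK.
- move=> [s|p] [t|q] [u|r] //; rewrite /crossing /= ?orbF.
  + by move=> _; apply: stem_apart.
  + by move=> _; apply: stem_apart.
  + by move/negP.
  + move=> /negbNE/eqP pq; rewrite -pq eqxx /= orbb => pr.
    by have := aligned_apart p.2 q.2 pr; case: (aligned _ _ _ _) => //= t; rewrite orbb.
Qed.

End Assembly.

End CandelabraCriterion.

(** * Quadrupling *)

Section EvenCyclic.

Local Open Scope ring_scope.

Variable n : nat.
Implicit Types x y z : 'I_n.*2.+2.

Definition antipode : 'I_n.*2.+2 := inZp n.+1.
Definition half_ord x : 'I_n.*2.+2 := inZp x./2.
Definition upper x : bool := (n < x)%N.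

Lemma odd_modn_even m : odd (m %% n.*2.+2) = odd m.
Proof. by rewrite odd_mod //= negbK odd_double. Qed.

Lemma val_ordD x y : (x + y)%R = ((x + y) %% n.*2.+2)%N :> nat.
Proof. by []. Qed.

Lemma val_ordB x y : (x - y)%R = (if y <= x then x - y else x + n.*2.+2 - y)%N :> nat.
Proof.
have [ltx lty] := (ltn_ord x, ltn_ord y); rewrite [LHS]/= modnDmr.
case: leqP => yx; last by rewrite addnBA ?modn_small //; lia.
have -> : (x + (n.*2.+2 - y) = (x - y) + n.*2.+2)%N by lia.
by rewrite modnDr modn_small //; lia.
Qed.

Lemma odd_ordD x y : odd (x + y)%R = odd x (+) odd y.
Proof. by rewrite odd_modn_even oddD. Qed.

Lemma odd_ordN x : odd (- x)%R = odd x.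
Proof.
have := odd_ordD x (- x); rewrite subrr /=.
by case: (odd x); case: (odd (- x)%R).
Qed.

Lemma val_antipode : antipode = n.+1 :> nat.
Proof. by rewrite /= modn_small //; lia. Qed.

Lemma antipodeD : antipode + antipode = 0.
Proof. by apply/ord_inj; rewrite val_ordD val_antipode addnn doubleS modnn. Qed.

Lemma antipodeN : - antipode = antipode.
Proof. by apply/eqP; rewrite eq_sym -addr_eq0 antipodeD. Qed.

Lemma half_ordK x : ~~ odd x -> half_ord x + half_ord x = x.
Proof.
move=> even_x; apply/ord_inj => /=; rewrite modnDm addnn even_halfK //.
by rewrite modn_small.
Qed.

Lemma double_eq x y : x + x = y + y -> x = y \/ x = y + antipode.
Proof.
move=> xxyy; have : (x - y) + (x - y) = 0 by rewrite addrACA -opprD xxyy subrr.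
move: (x - y) (subrK y x) => d <- /(congr1 (@nat_of_ord _)); rewrite val_ordD => dd.
have [d_lt|d_ge] := ltnP d n.+1; [left|right]; have lt := ltn_ord d.
  by rewrite modn_small /= in dd; [rewrite (_ : d = 0) ?add0r //; apply/ord_inj => /= |]; lia.
rewrite [d](_ : _ = antipode) 1?addrC //; apply/ord_inj; rewrite val_antipode.
move: dd; have -> : (d + d = (d + d - n.*2.+2) + n.*2.+2)%N by lia.
by rewrite modnDr modn_small /=; lia.
Qed.

Lemma upperD x : upper (x + antipode) = ~~ upper x.
Proof.
rewrite /upper val_ordD val_antipode; have lt := ltn_ord x.
case: (ltnP n x) => nx; last by rewrite modn_small; lia.
have -> : (x + n.+1 = (x - n.+1) + n.*2.+2)%N by lia.
by rewrite modnDr modn_small; lia.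
Qed.

Definition antipodal_pos x : nat := (x %% n.+1).*2 + upper x.

Let modn_upper x : (x %% n.+1 = if upper x then x - n.+1 else x)%N.
Proof.
rewrite /upper; case: ltnP => nx; last by rewrite modn_small.
by rewrite -{1}(subnK nx) modnDr modn_small //; have := ltn_ord x; lia.
Qed.

Lemma numbering_antipodal : numbering antipodal_pos.
Proof.
split=> [x y|x]; rewrite /antipodal_pos ?card_ord !modn_upper /upper.
  move=> e; apply/ord_inj; have [lx ly] := (ltn_ord x, ltn_ord y).
  by move: e; case: (ltnP n x) => ?; case: (ltnP n y) => ?; lia.
by have := ltn_ord x; case: (ltnP n x) => ?; lia.
Qed.

Lemma step_pair_antipodal x y : step_pair antipodal_pos x y -> y - x = antipode.
Proof.
rewrite /step_pair /antipodal_pos !modn_upper /upper => xy.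
apply/ord_inj; rewrite val_ordB val_antipode; have [lx ly] := (ltn_ord x, ltn_ord y).
by move: xy; case: (ltnP n x) => ?; case: (ltnP n y) => ?; case: ifP => ?; lia.
Qed.

End EvenCyclic.

Section Quadrupling.

Local Open Scope ring_scope.

Variable n : nat.
Let Z := 'I_n.*2.+2.
Variable g : ternary Z.
Hypothesis gO : one_factorization g.

Let W := (bool * bool)%type.
Let point := candelabra_point bool Z W.
Implicit Types (i j : W) (x y z : Z) (p q r : W * Z) (l : bool).

Let mate i : W := (i.1, ~~ i.2).

(* Two groups [(b, _)] form a side. If [p], [q] lie in the two groups of one side and
   [z], [z'] in group [j] of the other, then [{p, q, z, z'}] is a block iff
   [z + z' = p + q + shift j]; when [z = z'] the fourth point is in the stem instead. *)
Let shift j : Z := match j with (false, true) => -1 | (true, true) => 1 | _ => 0 end.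

Let gap (c : bool) x (d : bool) z : Z :=
  if c == d then if c then x - z + 1 else x - z else z - x.

Let label q p : bool :=
  if q.1.1 then upper (gap p.1.2 p.2 q.1.2 q.2) else ~~ upper (gap q.1.2 q.2 p.1.2 p.2).

Let label_swap p q : p.1.1 != q.1.1 -> label p q = ~~ label q p.
Proof. by case: p q => [[[] c] x] [[[] d] y] //= _; rewrite /label /= ?negbK. Qed.

Let label_mate i x y q : i.1 != q.1.1 -> q.2 + q.2 = x + y + shift q.1 ->
  label q (i, x) = label q (mate i, y).
Proof.
case: q => j z /= ij zz; have -> : x = z + z - y - shift j by rewrite zz; ring.
by case: i j ij {zz} => [[] []] [[] []] //= _; rewrite /label /gap /shift /=;
  (try congr negb); congr upper; ring.
Qed.

Let label_antipode j z p : label (j, z + antipode n) p = ~~ label (j, z) p.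
Proof.
have gapDl c w d t : gap c (w + antipode n) d t = gap c w d t + antipode n.
  by rewrite /gap; case: c d => [] [] /=; rewrite ?opprD ?antipodeN; ring.
have gapDr c w d t : gap c w d (t + antipode n) = gap c w d t + antipode n.
  by rewrite /gap; case: c d => [] [] /=; rewrite ?opprD ?antipodeN; ring.
by rewrite /label gapDl gapDr !upperD; case: j.1.
Qed.

Let odd_shift j : odd (shift j) = j.2.
Proof. by case: j => [[] []] //; rewrite /shift odd_ordN. Qed.

Let apex l i x y : W * Z :=
  let j := (~~ i.1, odd (x + y)%R) in
  let z := half_ord (x + y + shift j) in
  (j, if label (j, z) (i, x) == l then z else z + antipode n).

Let apexP l i x y (q := apex l i x y) :
  [/\ q.1.1 = ~~ i.1, q.2 + q.2 = x + y + shift q.1 & label q (i, x) = l].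
Proof.
rewrite {}/q /apex; set j : W := (~~ i.1, _); set z := half_ord _.
have zz : z + z = x + y + shift j by rewrite half_ordK // odd_ordD odd_shift addbb.
split=> //; first by case: ifP => // _; rewrite addrACA antipodeD addr0.
case: eqP => // ne; rewrite label_antipode.
by move: ne; case: (label (j, z) (i, x)) l => [] [].
Qed.

Let apex_uniq l i x y q : q.1.1 = ~~ i.1 -> q.2 + q.2 = x + y + shift q.1 ->
  label q (i, x) = l -> apex l i x y = q.
Proof.
move=> qi zz lq; have [q'i zz' lq'] := apexP l i x y.
have parity r : r.2 + r.2 = x + y + shift r.1 -> r.1.2 = odd (x + y)%R.
  move=> /(congr1 (fun t : Z => odd t)); rewrite odd_ordD addbb (odd_ordD (x + y)) odd_shift.
  by case: (odd _); case: r.1.2.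
have e1 : (apex l i x y).1 = q.1.
  by rewrite [LHS]surjective_pairing [RHS]surjective_pairing qi (parity _ zz).
rewrite e1 -zz in zz'; have [e2|e2] := double_eq zz'.
  by rewrite [LHS]surjective_pairing e1 e2 -surjective_pairing.
move: lq'; rewrite [apex _ _ _ _]surjective_pairing e1 e2 label_antipode -surjective_pairing lq.
by case: (l).
Qed.

Let quad_stem l p q : point :=
  if p.1.1 == q.1.1 then inr (apex l p.1 p.2 q.2) else
  if label p q == l then inr (mate q.1, p.2 + p.2 - shift p.1 - q.2)
  else inr (mate p.1, q.2 + q.2 - shift q.1 - p.2).

Let quad_aligned i x y r : point :=
  if i.1 == r.1.1 then inr (r.1, g x y r.2) else
  if x == y then inr r else inr (mate r.1, x + y - shift i - r.2).

Let quad_sides i x y r : point :=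
  let z := x + y + shift r.1 - r.2 in
  if z == r.2 then inl (label r (i, x)) else inr (r.1, z).

Let quad_transversal p q r : point :=
  if p.1.1 == q.1.1 then quad_sides p.1 p.2 q.2 r else
  if p.1.1 == r.1.1 then quad_sides p.1 p.2 r.2 q else quad_sides q.1 q.2 r.2 p.

Definition quadrupling : ternary (candelabra_point bool 'I_n.*2.+2 (bool * bool)) :=
  assemble quad_stem quad_aligned quad_transversal.

Arguments quadrupling : simpl never.

Let mateP i j : i.1 = j.1 -> i != j -> j = mate i.
Proof. by case: i j => [[] []] [[] []]. Qed.

Let mate_neq i : (i == mate i) = false.
Proof. by case: i => [[] []]. Qed.

Let sideN i j : i.1 != j.1 -> j.1 = ~~ i.1.
Proof. by case: i j => [[] c] [[] d]. Qed.

Let side_neq i j : i.1 != j.1 -> (i == j) = false.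
Proof. by case: i j => [[] c] [[] d]. Qed.

Let quad_stemC l p q : p.1 != q.1 -> quad_stem l p q = quad_stem l q p.
Proof.
case: p q => [i x] [j y] /= ij; rewrite /quad_stem /= eq_sym; case: (altP (_ =P _)) => s.
  rewrite (mateP (esym s) ij); have [mi zz lz] := apexP l i x y.
  congr inr; apply/esym/apex_uniq; rewrite // ?zz 1?[x + y]addrC //.
  by rewrite -[RHS]lz; apply/esym/label_mate => //; rewrite mi; case: i.1.
rewrite (@label_swap (i, x)) 1?eq_sym //.
by case: (label (j, y) (i, x)) l => [] [].
Qed.

Let quad_alignedC i x y r : i != r.1 -> quad_aligned i x y r = quad_aligned i y x r.
Proof. by rewrite /quad_aligned (ofacC gO) (eq_sym x) [x + y]addrC. Qed.

Let quad_sidesC i x y r : i.1 != r.1.1 -> quad_sides i x y r = quad_sides (mate i) y x r.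
Proof.
move=> ir; rewrite /quad_sides [x + y]addrC; case: eqP => // zz.
by congr inl; apply: label_mate => //; rewrite -{1}zz; ring.
Qed.

Let quad_transversalC12 p q r : in_distinct_groups p q r ->
  quad_transversal p q r = quad_transversal q p r.
Proof.
case: p q r => [i x] [j y] [k z]; rewrite /in_distinct_groups /quad_transversal /=.
by case: i j k => [[] []] [[] []] [[] []] //= _; exact: quad_sidesC.
Qed.

Let quad_transversalC23 p q r : in_distinct_groups p q r ->
  quad_transversal p q r = quad_transversal p r q.
Proof.
case: p q r => [i x] [j y] [k z]; rewrite /in_distinct_groups /quad_transversal /=.
by case: i j k => [[] []] [[] []] [[] []] //= _; exact: quad_sidesC.
Qed.

Let quadC12 a b c : crossing a b c -> quadrupling a b c = quadrupling b a c.
Proof. exact: (assembleC12 quad_stemC quad_alignedC quad_transversalC12). Qed.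

Let quadC23 a b c : crossing a b c -> quadrupling a b c = quadrupling a c b.
Proof. exact: (assembleC23 quad_stemC quad_alignedC quad_transversalC23). Qed.

Let quad_sidesE i x y r : i.1 != r.1.1 ->
  quadrupling (inr (i, x)) (inr (mate i, y)) (inr r) = quad_sides i x y r.
Proof.
move=> ir; rewrite /quadrupling /= mate_neq (side_neq ir) (@side_neq (mate i)) //.
by rewrite /quad_transversal eqxx.
Qed.

Let quad_sidesE' i x y r : i.1 != r.1.1 ->
  quadrupling (inr (i, x)) (inr r) (inr (mate i, y)) = quad_sides i x y r.
Proof.
by move=> ir; rewrite -quad_sidesE // [RHS]quadC23 // crossing_apart12 //= mate_neq.
Qed.

Let quad_alignedE p j y z : p.1 != j ->
  quadrupling (inr p) (inr (j, y)) (inr (j, z)) = quad_aligned j y z p.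
Proof. by move=> pj; rewrite /quadrupling /= (negbTE pj) eqxx. Qed.

Let quad_stemK l p q : p.1 != q.1 -> quadrupling (inr p) (inr q) (quad_stem l p q) = inl l.
Proof.
have opposite i x j y : i.1 != j.1 ->
    quad_sides i x (y + y - shift j - x) (j, y) = inl (label (j, y) (i, x)).
  by move=> _; rewrite /quad_sides /= (_ : _ - y = y) ?eqxx //; ring.
case: p q => [i x] [j y] /= ij; rewrite /quad_stem /=; case: (altP (i.1 =P j.1)) => s.
  have [mi zz lz] := apexP l i x y.
  rewrite (mateP s ij) quad_sidesE ?mi /quad_sides; last by case: i.1.
  by rewrite -zz addrK eqxx lz.
case: eqP => lij.
  by rewrite quadC12 ?crossing_apart12 // quad_sidesE' ?opposite 1?eq_sym // lij.
rewrite quad_sidesE' // opposite //; congr inl.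
by move: lij; rewrite label_swap //; case: (label _ _) l => [] [].
Qed.

Let quad_alignedK p z q : p.1 != q.1 ->
  quadrupling (inr p) (inr q) (quad_aligned p.1 p.2 z q) = inr (p.1, z).
Proof.
case: p q => [i x] [j y] /= ij; rewrite /quad_aligned /=.
case: (altP (i.1 =P j.1)) => [s|s].
  by rewrite quad_alignedE // /quad_aligned s eqxx (ofac_edge gO) (ofac_left gO).
case: (altP (x =P z)) => [<-|xz].
  by rewrite quad_alignedE // /quad_aligned eq_sym (negbTE s) eqxx.
rewrite quadC12 ?crossing_apart12 // quad_sidesE' 1?eq_sym // /quad_sides /=.
rewrite (_ : _ - x = z); last by ring.
by rewrite eq_sym (negbTE xz).
Qed.

Let quad_sidesK p q z : p.1.1 != q.1.1 ->
  quadrupling (inr p) (inr q) (quad_sides p.1 p.2 z q) = inr (mate p.1, z).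
Proof.
case: p q => [i x] [j y] /= s; rewrite /quad_sides /=; case: eqP => zz.
  rewrite /quadrupling /= /quad_stem /= (negbTE s) (label_swap (p := (i, x))) //.
  rewrite (_ : _ == _ = false); last by case: (label _ _).
  by congr (inr (_, _)); rewrite -{1}zz; ring.
rewrite quad_alignedE ?side_neq // /quad_aligned eq_sym (negbTE s) eq_sym /=.
by case: eqP => // _; congr (inr (_, _)); ring.
Qed.

Let quad_transversalK p q r : in_distinct_groups p q r ->
  quadrupling (inr p) (inr q) (quad_transversal p q r) = inr r.
Proof.
case: p q r => [i x] [j y] [k z] /and3P[/= ij ik jk]; rewrite /quad_transversal /=.
case: (altP (i.1 =P j.1)) => [s|s].
  have ik1 : i.1 != k.1 by move: ij ik jk s; case: i j k => [[] []] [[] []] [[] []].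
  rewrite (mateP s ij) /quad_sides /=; case: eqP => zz.
    rewrite /quadrupling /= /quad_stem /= eqxx; congr inr; apply: apex_uniq => //=.
      exact: sideN.
    by rewrite -{1}zz; ring.
  rewrite quad_sidesE // /quad_sides /= (_ : _ - (_ - z) = z); last by ring.
  by case: eqP => // zz'; case: zz.
case: (altP (i.1 =P k.1)) => [s'|s']; first by rewrite (mateP s' ik) (quad_sidesK (p := (i, x))).
have jk1 : j.1 = k.1 by case: i.1 j.1 k.1 s s' => [] [] [].
by rewrite quadC12 ?crossing_apart12 // (quad_sidesK (p := (j, y))) 1?eq_sym // (mateP jk1 jk).
Qed.

Let quad_stem_apart l p q : p.1 != q.1 -> apart (inr p) (quad_stem l p q).
Proof.
move=> pq; rewrite /quad_stem; case: (altP (p.1.1 =P q.1.1)) => s /=.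
  by have [mi _ _] := apexP l p.1 p.2 q.2; rewrite side_neq // mi; case: p.1.1.
by case: eqP => _ /=; rewrite ?mate_neq // side_neq.
Qed.

Let quad_aligned_apart i x y r : i != r.1 -> apart (inr (i, x)) (quad_aligned i x y r).
Proof.
move=> ir; rewrite /quad_aligned; case: (altP (i.1 =P r.1.1)) => s //.
by case: eqP => _ //=; rewrite side_neq.
Qed.

Let quad_aligned_same i x r : i != r.1 -> quad_aligned i x x r = inr r.
Proof. by move=> _; rewrite /quad_aligned (ofac_same gO) eqxx -surjective_pairing; case: ifP. Qed.

Lemma quadrupling_candelabra : candelabra quadrupling.
Proof.
exact: (assemble_candelabra quad_stemC quad_alignedC quad_transversalC12 quad_transversalC23
  quad_aligned_same quad_stemK quad_alignedK quad_transversalK quad_stem_apart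
  quad_aligned_apart).
Qed.

Lemma quadrupling_stepped (posG : Z -> nat) :
  stepped_candelabra posG (lex_pos nat_of_bool nat_of_bool) quadrupling.
Proof.
move=> i x y [j z] /andP[_ /eqP yx] ji.
have xy : x != y by apply/eqP=> e; move: yx; rewrite e => /n_Sn.
rewrite /quadrupling /= eqxx /quad_aligned (negbTE xy) /=; case: ifP => s.
  by exists (j, g x y z).
exists (mate j, x + y - shift i - z) => //=.
by case: i j s ji => [[] []] [[] []]; rewrite /lex_pos /= card_bool.
Qed.

End Quadrupling.

Theorem step_order_quadruple n : 0 < n -> step_order n.*2.+2 -> step_order (4 * n.*2 + 2).
Proof.
case: n => // n _; have [g gO] : exists g : ternary 'I_n.*2.+2, one_factorization g.
  by apply: one_factorization_exists; rewrite card_ord /= odd_double.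
have := step_order_fill numbering_bool (numbering_ord n.*2.+2)
  (numbering_lex numbering_bool numbering_bool) _ _ _ (quadrupling_candelabra gO)
  (@quadrupling_stepped n g (@nat_of_ord _)).
rewrite card_prod card_bool card_ord /= odd_double [4 * _ + 2]addnC.
exact: (fun fill => fill isT isT isT).
Qed.

(** * Inflation *)

(* The blocks through [None] form a Steiner triple system, whose blocks are the lines. *)
Section DerivedTripleSystem.

Variables (W : finType) (F : ternary (option W)).
Hypothesis FS : skein F.
Implicit Types (x y z u v : W) (L : {set W}).

Definition third x y : W := odflt x (F None (Some x) (Some y)).

Lemma thirdE x y : x != y -> F None (Some x) (Some y) = Some (third x y).
Proof.
move=> xy; rewrite /third; case Fxy: (F _ _ _) => //=.
by move/eqP: Fxy; rewrite (skein_eq1 FS) => /eqP[] /eqP; rewrite (negbTE xy).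
Qed.

Lemma third_eq_None x y z : x != y -> (F (Some x) (Some y) (Some z) == None) = (z == third x y).
Proof.
move=> /thirdE xy; have [_ _ xyt] := skein_block FS xy.
apply/eqP/eqP => [xyz|->]; last exact: xyt.
have [xyz' _ _] := skein_block FS xyz.
by apply: Some_inj; rewrite -xyz' -xy (skeinC12 FS None) (skeinC23 FS _ None).
Qed.

Lemma thirdC x y : x != y -> third x y = third y x.
Proof. by move=> xy; rewrite {1}/third (skeinC23 FS) thirdE 1?eq_sym. Qed.

Lemma third_neq x y : x != y -> (third x y != x) /\ (third x y != y).
Proof.
by move=> xy; split; rewrite -(inj_eq Some_inj) -(thirdE xy) ?(skein_eq2 FS) ?(skein_eq3 FS).
Qed.

Lemma thirdK x y : x != y -> third x (third x y) = y.
Proof. by move=> xy; rewrite {1}/third -thirdE // (skeinK FS). Qed.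

Definition line x y : {set W} := [set x; y; third x y].

Definition lines : {set {set W}} := [set line t.1 t.2 | t : W * W & t.1 != t.2].

Lemma linesP L : reflect (exists x y, x != y /\ L = line x y) (L \in lines).
Proof.
apply: (iffP imsetP) => [[[x y]]|[x [y [xy ->]]]].
  by rewrite in_set => xy ->; exists x, y.
by exists (x, y); rewrite ?in_set.
Qed.

Lemma line_ends x y : x != y -> [/\ line x y \in lines, x \in line x y & y \in line x y].
Proof. by move=> xy; rewrite !inE !eqxx orbT; split=> //; apply/linesP; exists x, y. Qed.

Lemma card_lines L : L \in lines -> #|L| = 3.
Proof.
case/linesP=> x [y [xy ->]]; have [tx ty] := third_neq xy.
by rewrite /line setUC cardsU1 cards2 !inE xy negb_or tx ty.
Qed.

Lemma lines_eq L u v : L \in lines -> u \in L -> v \in L -> u != v -> L = line u v.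
Proof.
case/linesP=> x [y [xy ->]].
have [tx ty] := third_neq xy; have yx : y != x by rewrite eq_sym.
have yxE := thirdC yx.
have ytE : third y (third x y) = x by rewrite -yxE thirdK.
have thirds := (thirdK xy, ytE, yxE, thirdC tx, thirdC ty).
by rewrite !inE -!orbA => /or3P[] /eqP-> /or3P[] /eqP->; rewrite ?eqxx // => _;
   apply/setP=> z; rewrite !inE ?thirds;
   case: (z == x); case: (z == y); case: (z == third x y).
Qed.

End DerivedTripleSystem.

(* No block through a pair of the order of [G] meets two further groups. *)
Definition flat_pairs (S G W : eqType) (posG : G -> nat)
    (h : ternary (candelabra_point S G W)) : Prop :=
  forall i j x y z, i != j -> step_pair posG x y ->
    exists t, h (inr (i, x)) (inr (i, y)) (inr (j, z)) = inr (j, t).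

Definition parallel_pairs (S G W : eqType) (h : ternary (candelabra_point S G W)) : Prop :=
  forall i j x y, i != j -> h (inr (i, x)) (inr (j, x)) (inr (i, y)) = inr (j, y).

Lemma parallel_pairs_other (S G W : eqType) (h : ternary (candelabra_point S G W)) i j x c :
  candelabra h -> parallel_pairs h -> i != j ->
  group_index c != Some i -> group_index c != Some j ->
  let d := h (inr (i, x)) (inr (j, x)) c in group_index d != Some i /\ group_index d != Some j.
Proof.
case=> hC12 hC23 h12 hK par ij ci cj /=.
have ijc : crossing (inr (i, x)) (inr (j, x)) c by rewrite crossing_apart12.
have [_] := hK _ _ _ ijc; case: (h _ _ c) => [//|[m y]] /= ijd; split; apply/eqP=> -[mE].
  by move: cj; rewrite -ijd mE par // eqxx.
by move: ci; rewrite -ijd mE hC12 ?crossing_apart12 // par 1?eq_sym // eqxx.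
Qed.

(* Blow up the points of a quadruple system other than [None]: blocks avoiding [None]
   become transversal designs, blocks through [None] candelabra systems with three groups. *)
Section Inflation.

Variables (S : eqType) (G : zmodType) (W : finType) (w0 : W).
Variables (F : ternary (option W)) (h : ternary (candelabra_point S G 'I_3)).
Hypotheses (FS : skein F) (hC : candelabra h).

Local Notation point := (candelabra_point S G W).
Implicit Types (x y : W) (L : {set W}) (a b c d : point) (p q r : W * G).

Definition on_line L a : bool := if a is inr p then p.1 \in L else true.

Definition collinear L a b c : bool := [&& on_line L a, on_line L b & on_line L c].

Definition encode L a : candelabra_point S G 'I_3 :=
  match a with inl s => inl s | inr p => inr (inord (index p.1 (enum L)), p.2) end.

Definition decode L (a : candelabra_point S G 'I_3) : point :=
  match a with inl s => inl s | inr p => inr (nth w0 (enum L) p.1, p.2) end.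

Let size_line L : L \in lines F -> size (enum L) = 3.
Proof. by move=> LF; rewrite -cardE (card_lines FS). Qed.

Let nth_line L x : L \in lines F -> x \in L ->
  nth w0 (enum L) (inord (index x (enum L)) : 'I_3) = x.
Proof.
by move=> LF xL; rewrite inordK ?nth_index ?mem_enum // -(size_line LF) index_mem mem_enum.
Qed.

Lemma encodeK L : L \in lines F -> {in on_line L, cancel (encode L) (decode L)}.
Proof. by move=> LF [s|[x g]] //; rewrite unfold_in /= => xL; rewrite nth_line. Qed.

Lemma decodeK L : L \in lines F -> cancel (decode L) (encode L).
Proof.
move=> LF [s|[i g]] //=.
by rewrite index_uniq ?enum_uniq ?size_line // inord_val.
Qed.

Lemma on_line_decode L e : L \in lines F -> on_line L (decode L e).
Proof. by move=> LF; case: e => [s|[i g]] //=; rewrite -mem_enum mem_nth ?size_line. Qed.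

Lemma apart_encode L a b : L \in lines F -> on_line L a -> on_line L b ->
  apart (encode L a) (encode L b) = apart a b.
Proof.
move=> LF; case: a b => [s|[x g]] [t|[y g']] //= xL yL; congr negb.
by apply/eqP/eqP => [e|-> //]; rewrite -(nth_line LF xL) e nth_line.
Qed.

Lemma crossing_encode L a b c : L \in lines F -> collinear L a b c ->
  crossing (encode L a) (encode L b) (encode L c) = crossing a b c.
Proof. by move=> LF /and3P[aL bL cL]; rewrite /crossing !apart_encode. Qed.

Lemma collinearC12 L a b c : collinear L a b c = collinear L b a c.
Proof. by rewrite /collinear andbCA. Qed.

Lemma collinearC23 L a b c : collinear L a b c = collinear L a c b.
Proof. by rewrite /collinear [on_line L b && _]andbC. Qed.

Lemma collinear_uniq L L' a b c : L \in lines F -> L' \in lines F -> crossing a b c ->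
  collinear L a b c -> collinear L' a b c -> L = L'.
Proof.
move=> LF L'F abc /and3P[aL bL cL] /and3P[aL' bL' cL'].
have apart_eq d e : apart d e -> on_line L d -> on_line L e ->
    on_line L' d -> on_line L' e -> L = L'.
  case: d e => [s|[x g]] [t|[y k]] //= xy xL yL xL' yL'.
  by rewrite (lines_eq FS LF xL yL xy) (lines_eq FS L'F xL' yL' xy).
by case/or3P: abc => /apart_eq; apply.
Qed.

Definition transversal_fourth a b c : point :=
  match a, b, c with
  | inr p, inr q, inr r =>
    if F (Some p.1) (Some q.1) (Some r.1) is Some w then inr (w, - (p.2 + q.2 + r.2))%R else a
  | _, _, _ => a
  end.

Definition inflate a b c : point :=
  if [pick L in lines F | collinear L a b c] is Some L
  then decode L (h (encode L a) (encode L b) (encode L c)) else transversal_fourth a b c.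

Lemma inflate_collinear L a b c : L \in lines F -> collinear L a b c -> crossing a b c ->
  inflate a b c = decode L (h (encode L a) (encode L b) (encode L c)).
Proof.
move=> LF abcL abc; rewrite /inflate; case: pickP => [L' /andP[L'F abcL']|/(_ L)].
  by rewrite (collinear_uniq L'F LF abc abcL' abcL).
by rewrite LF abcL.
Qed.

Lemma inflate_transversal p q r w : in_distinct_groups p q r ->
  F (Some p.1) (Some q.1) (Some r.1) = Some w ->
  inflate (inr p) (inr q) (inr r) = inr (w, - (p.2 + q.2 + r.2))%R.
Proof.
move=> /and3P[pq pr qr] pqr; rewrite /inflate /transversal_fourth pqr.
case: pickP => // L /and4P[LF pL qL rL]; suff: Some w = None by [].
apply/eqP; rewrite -pqr (third_eq_None FS _ pq); move: (rL); rewrite /= (lines_eq FS LF pL qL pq).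
by rewrite !inE eq_sym (negbTE pr) eq_sym (negbTE qr).
Qed.

Lemma inflateP a b c : crossing a b c ->
  (exists2 L, L \in lines F & collinear L a b c) \/
  (exists p q r w, [/\ a = inr p, b = inr q, c = inr r, in_distinct_groups p q r &
    F (Some p.1) (Some q.1) (Some r.1) = Some w]).
Proof.
case: a b c => [s|p] [t|q] [u|r]; rewrite /crossing /= ?orbF // /collinear /=.
- by move=> /(line_ends F)[LF qL rL]; left; exists (line F q.1 r.1); rewrite ?qL.
- by move=> /(line_ends F)[LF pL rL]; left; exists (line F p.1 r.1); rewrite ?pL.
- by move=> /(line_ends F)[LF pL qL]; left; exists (line F p.1 q.1); rewrite ?pL ?qL.
case: (altP (p.1 =P q.1)) => [<- /= | pq _].
  by rewrite orbb => /(line_ends F)[LF pL rL]; left; exists (line F p.1 r.1); rewrite ?pL.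
have [LF pL qL] := line_ends F pq.
case: (altP (p.1 =P r.1)) => [pr|pr]; first by left; exists (line F p.1 q.1); rewrite -?pr ?pL ?qL.
case: (altP (q.1 =P r.1)) => [qr|qr]; first by left; exists (line F p.1 q.1); rewrite -?qr ?pL ?qL.
case Fpqr: (F (Some p.1) (Some q.1) (Some r.1)) => [w|].
  by right; exists p, q, r, w; split; rewrite // /in_distinct_groups pq pr.
left; exists (line F p.1 q.1); rewrite // pL qL.
by move/eqP: Fpqr; rewrite (third_eq_None FS _ pq) !inE => ->; rewrite orbT.
Qed.

Lemma inflateC12 a b c : crossing a b c -> inflate a b c = inflate b a c.
Proof.
have [hC12 _ _ _] := hC.
move=> abc; have [[L LF abcL]|[p [q [r [w [-> -> -> pqr Fpqr]]]]]] := inflateP abc.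
  rewrite (inflate_collinear LF abcL abc) hC12 ?crossing_encode //.
  by rewrite -inflate_collinear 1?collinearC12 1?crossingC12.
rewrite (inflate_transversal pqr Fpqr); rewrite (skeinC12 FS) in Fpqr.
rewrite (inflate_transversal _ Fpqr) 1?[(q.2 + _)%R]addrC //.
by move: pqr; rewrite /in_distinct_groups [p.1 == _]eq_sym [X in _ && X]andbC.
Qed.

Lemma inflateC23 a b c : crossing a b c -> inflate a b c = inflate a c b.
Proof.
have [_ hC23 _ _] := hC.
move=> abc; have [[L LF abcL]|[p [q [r [w [-> -> -> pqr Fpqr]]]]]] := inflateP abc.
  rewrite (inflate_collinear LF abcL abc) hC23 ?crossing_encode //.
  by rewrite -inflate_collinear 1?collinearC23 1?crossingC23.
rewrite (inflate_transversal pqr Fpqr); rewrite (skeinC23 FS) in Fpqr.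
rewrite (inflate_transversal _ Fpqr) 1?addrAC //.
by move: pqr; rewrite /in_distinct_groups andbCA [q.1 == _]eq_sym.
Qed.

Lemma inflate_candelabra : candelabra inflate.
Proof.
have [_ _ h12 hK] := hC; split; [exact: inflateC12 | exact: inflateC23 | |].
  move=> a b ab; have aab : crossing a a b by rewrite crossing_apart23.
  have [[L LF aabL]|[p [q [r [w [-> [->] _ /and3P[]]]]]]] := inflateP aab; last by rewrite eqxx.
  have /and3P[aL _ bL] := aabL.
  by rewrite (inflate_collinear LF aabL aab) h12 ?apart_encode ?(encodeK LF).
move=> a b c abc; have [[L LF abcL]|[p [q [r [w [-> -> -> pqr Fpqr]]]]]] := inflateP abc.
  have /and3P[aL bL cL] := abcL.
  have [] := hK (encode L a) (encode L b) (encode L c); first by rewrite crossing_encode.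
  rewrite (inflate_collinear LF abcL abc); set e := h _ _ _ => abe eK.
  have abdL : collinear L a b (decode L e) by rewrite /collinear aL bL on_line_decode.
  have abd : crossing a b (decode L e) by rewrite -(crossing_encode LF) // (decodeK LF).
  by split=> //; rewrite (inflate_collinear LF abdL abd) (decodeK LF) eK (encodeK LF).
have /and3P[pq pr qr] := pqr; have [pqw _ _] := skein_block FS Fpqr.
split; first by rewrite crossing_apart12.
rewrite (inflate_transversal pqr Fpqr) (inflate_transversal (r := (w, _)) _ pqw) /=.
  by rewrite opprB addrAC subrr add0r -surjective_pairing.
rewrite /in_distinct_groups pq andTb; apply/andP; split; rewrite eq_sym -(inj_eq Some_inj) -Fpqr.
  by rewrite (skein_eq1 FS) (inj_eq Some_inj).
by rewrite (skein_eq2 FS) (inj_eq Some_inj).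
Qed.

Lemma inflate_stepped (posG : G -> nat) (posW : W -> nat) :
  flat_pairs posG h -> stepped_candelabra posG posW inflate.
Proof.
move=> flat i x y [j z] xy ji; have {ji} [ij ji] : i != j /\ posW j < posW i.
  by split=> //; apply/eqP=> e; move: ji; rewrite e ltnn.
have [ijL iL jL] := line_ends F ij.
have := apart_encode (a := inr (i, x)) (b := inr (j, z)) ijL iL jL; rewrite /= ij => ij'.
have [t ijt] := flat _ _ x y z ij' xy.
exists (j, t) => //; rewrite (inflate_collinear ijL) ?crossing_apart23 //.
  by rewrite /encode ijt /= nth_line.
by rewrite /collinear /= iL jL.
Qed.

Lemma inflate_parallel : parallel_pairs h -> parallel_pairs inflate.
Proof.
move=> par i j x y ij.
have [ijL iL jL] := line_ends F ij.
have := apart_encode (a := inr (i, x)) (b := inr (j, x)) ijL iL jL; rewrite /= ij => ij'.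
rewrite (inflate_collinear ijL) ?crossing_apart12 //.
  by rewrite /encode par //= nth_line.
by rewrite /collinear /= iL jL.
Qed.

Lemma group_index_inflate i j (x y : G) c : i != j ->
  let k := group_index (inflate (inr (i, x)) (inr (j, y)) c) in
  k \in block F None (Some i) (Some j) \/ k = F (Some i) (Some j) (group_index c).
Proof.
move=> ij /=; have ijc : crossing (inr (i, x)) (inr (j, y)) c by rewrite crossing_apart12.
have [[L LF ijcL]|[_ [_ [r [w [[<-] [<-] -> ijr Fpqr]]]]]] := inflateP ijc; last first.
  by right; rewrite (inflate_transversal ijr Fpqr) Fpqr.
left; rewrite (inflate_collinear LF ijcL ijc); case/and3P: ijcL => iL jL _.
have := on_line_decode (h (encode L (inr (i, x))) (encode L (inr (j, y))) (encode L c)) LF.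
case: (decode _ _) => [//|[k z]] /=; rewrite (lines_eq FS LF iL jL ij) !inE -!orbA.
by rewrite (thirdE FS ij) !(inj_eq Some_inj).
Qed.

End Inflation.

Theorem step_order_inflate (S : finType) (G : finZmodType) (posS : S -> nat) (posG : G -> nat)
    (h : ternary (candelabra_point S G 'I_3)) n :
  numbering posS -> numbering posG -> (#|S| == 2) || (#|S| == 4) -> ~~ odd #|G| -> 0 < n ->
  candelabra h -> flat_pairs posG h ->
  step_order n.+1 -> step_order (#|S| + #|G|) -> step_order (#|S| + n * #|G|).
Proof.
move=> numS numG S24 evenG n0 hC flat.
have -> : n.+1 = #|{: option 'I_n}| by rewrite card_option card_ord.
move=> /(step_orderP (numbering_option (numbering_ord n)))[F [FS _]].
rewrite -[X in _ -> step_order (_ + X * _)]card_ord.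
apply: (step_order_fill numS numG (numbering_ord n) S24 evenG _
  (inflate_candelabra (Ordinal n0) FS hC)); first by rewrite card_ord.
exact: inflate_stepped.
Qed.

(* When [#|G|] is odd, the stem point and the group [None] fill the first pairs, and every
   further pair [{x, y}] of groups contributes the pairs [{(x, g), (y, g)}]. *)
Section InflatedPairs.

Variables (G : finZmodType) (posG : G -> nat) (m : nat).
Hypothesis numG : numbering posG.

Let W : finType := option ('I_m * bool).
Let posW : W -> nat := option_pos (lex_pos (@nat_of_ord m) nat_of_bool).
Let numW : numbering posW :=
  numbering_option (numbering_lex numbering_bool (numbering_ord m)).

Let point := candelabra_point 'I_1 G W.

Let rearrange (a : point) : ('I_1 + G) + 'I_m * (G * bool) :=
  match a with
  | inl s => inl (inl s)
  | inr (None, x) => inl (inr x)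
  | inr (Some (t, b), x) => inr (t, (x, b))
  end.

Let first_pos : 'I_1 + G -> nat := sum_pos (@nat_of_ord 1) posG.
Let num_first_pos : numbering first_pos := numbering_sum (numbering_ord 1) numG.

Let pair_pos : G * bool -> nat := lex_pos posG nat_of_bool.
Let num_pair_pos : numbering pair_pos := numbering_lex numbering_bool numG.

Let later_pos : 'I_m * (G * bool) -> nat := lex_pos (@nat_of_ord m) pair_pos.
Let num_later_pos : numbering later_pos := numbering_lex num_pair_pos (numbering_ord m).

Let pos : point -> nat := sum_pos first_pos later_pos \o rearrange.

Let rearrange_inj : injective rearrange.
Proof. by move=> [s|[[[t b]|] x]] [s'|[[[t' b']|] x']] //= [] => [->|-> -> ->|->]. Qed.

Let card_point : #|{: point}| = #|{: ('I_1 + G) + 'I_m * (G * bool)}|.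
Proof. by rewrite !card_sum !card_prod card_option card_prod !card_ord card_bool; lia. Qed.

Let num_pos : numbering pos :=
  numbering_comp rearrange_inj card_point (numbering_sum num_first_pos num_later_pos).

Let pos_to_group p q :
  (pos (to_group None p) < pos (to_group None q)) = (first_pos p < first_pos q).
Proof. by case: p q => [s|x] [t|y]. Qed.

Let ltn_pos_pair t x c :
  group_index c != Some (Some (t, false)) -> group_index c != Some (Some (t, true)) ->
  (pos c < pos (inr (Some (t, false), x))) =
  (option_pos posW (group_index c) < option_pos posW (Some (Some (t, false)))).
Proof.
rewrite /pos /=; case: c => [s|[[[t' b]|] y]].
- by rewrite ltn_addr // (num_first_pos.2 (inl s)).
- rewrite !(inj_eq Some_inj) !xpair_eqE /= ltn_add2l !ltnS.
  rewrite (ltn_lex_pos num_pair_pos (numbering_ord m)).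
  rewrite (ltn_lex_pos numbering_bool (numbering_ord m)).
  by case: (t' == t) b => [] [].
- by rewrite ltn_addr // (num_first_pos.2 (inr y)).
Qed.

Variables (h : ternary (candelabra_point 'I_1 G 'I_3)) (F : ternary (option W)).
Hypotheses (hC : candelabra h) (par : parallel_pairs h).
Hypotheses (FS : skein F) (F_step : stepped (option_pos posW) F).

Let inflation : ternary point := inflate None F h.

Let inflated_pair_step t x c : let a := inr (Some (t, false), x) in
  pos c < pos a -> pos (inflation a (inr (Some (t, true), x)) c) < pos a.
Proof.
set u := Some (t, false); set v := Some (t, true); move=> a c_lt.
have uv : u != v by rewrite (inj_eq Some_inj) xpair_eqE andbF.
have inflC : candelabra inflation := inflate_candelabra None FS hC.
have infl_parallel : parallel_pairs inflation := inflate_parallel None FS par.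
have swap y : (pos (inr (v, y)) < pos a) = (pos (inr (u, y)) < pos a).
  rewrite /pos /= !(ltn_add2l #|_|) !(ltn_lex_pos num_pair_pos (numbering_ord m)).
  by rewrite !(ltn_lex_pos numbering_bool numG) andbF.
have [cu|cu] := eqVneq (group_index c) (Some u).
  case: c cu c_lt => [//|[_ y]] /= [->] c_lt.
  by rewrite [inflation _ _ _]infl_parallel // swap.
have [cv|cv] := eqVneq (group_index c) (Some v).
  case: c cv {cu} c_lt => [//|[_ y]] /= [->] c_lt; have [inflC12 _ _ _] := inflC.
  by rewrite inflC12 ?crossing_apart12 // [inflation _ _ _]infl_parallel // -swap.
have uv_step : step_pair (option_pos posW) (Some u) (Some v).
  by rewrite /step_pair /posW /= /lex_pos card_bool /= addn0 addn1 muln2 /= odd_double /=.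
have [du dv] := parallel_pairs_other x inflC infl_parallel uv cu cv.
rewrite ltn_pos_pair //; rewrite ltn_pos_pair // in c_lt.
have [|->] := group_index_inflate None h FS x x c uv; last exact: F_step.
rewrite !inE (negbTE du) (negbTE dv) /= => /orP[/eqP->|/eqP->] //.
by rewrite (skeinC12 FS) (skeinC23 FS); apply: F_step.
Qed.

Let stem_closed f : skein f ->
  forall r s t : 'I_1, exists u : 'I_1, f (inl r : 'I_1 + G) (inl s) (inl t) = inl u.
Proof. by move=> fS r s t; exists t; rewrite (ord1 r) (ord1 s) (skein_same12 fS). Qed.

Let inflated_stem_step f p q c :
  skein f -> stepped first_pos f -> step_pair first_pos p q -> pos c < pos (to_group None p) ->
  pos (fill inflation f None (to_group None p) (to_group None q) c) < pos (to_group None p).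
Proof.
move=> fS f_step pq c_lt.
have posE : pos (to_group None p) = first_pos p by case: (p).
have [r cE] : exists r, c = to_group None r.
  case: c c_lt => [s _|[[[t b]|] y]]; [by exists (inl s) | | by exists (inr y)].
  by rewrite posE => /ltn_trans/(_ (num_first_pos.2 p)); rewrite ltnNge leq_addr.
by move: c_lt; rewrite cE (fill_to_group _ _ (stem_closed fS)) !pos_to_group; apply: f_step.
Qed.

Let inflated_fill_stepped f :
  skein f -> stepped first_pos f -> odd #|G| -> stepped pos (fill inflation f None).
Proof.
move=> fS f_step oddG a b c.
rewrite -[step_pair _ _ _]/(step_pair (sum_pos first_pos later_pos) (rearrange a) (rearrange b)).
rewrite (step_pair_sum _ num_first_pos); last by rewrite card_sum card_ord /= oddG.
have rearrange_inl d p : rearrange d = inl p -> d = to_group None p.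
  by case: d => [s|[[[t b']|] y]] //= [<-].
have rearrange_inr d t y b' : rearrange d = inr (t, (y, b')) -> d = inr (Some (t, b'), y).
  by case: d => [s|[[[t' b'']|] y']] //= [-> -> ->].
case aE: (rearrange a) => [p|[t [x u]]]; case bE: (rearrange b) => [q|[t' [y v]]] //.
  by rewrite (rearrange_inl _ _ aE) (rearrange_inl _ _ bE); apply: inflated_stem_step.
rewrite (rearrange_inr _ _ _ _ aE) (rearrange_inr _ _ _ _ bE).
rewrite (step_pair_lex num_pair_pos (numbering_ord m)); last first.
  by rewrite card_prod card_bool muln2 odd_double.
rewrite (step_pair_lex numbering_bool numG) ?card_bool // => /and3P[/eqP<- /eqP<- uv].
case: u v uv {aE bE} => [] [] // _.
rewrite fill_crossing; first exact: inflated_pair_step.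
by rewrite crossing_apart12 //= (inj_eq Some_inj) xpair_eqE andbF.
Qed.

Lemma step_order_inflate_pairs :
  odd #|G| -> step_order #|G|.+1 -> step_order (#|G| * m.*2.+1).+1.
Proof.
move=> oddG; have -> : #|G|.+1 = #|{: 'I_1 + G}| by rewrite card_sum card_ord.
move=> /(step_orderP num_first_pos)[f [fS f_step]].
have -> : (#|G| * m.*2.+1).+1 = #|{: point}|.
  by rewrite card_sum card_prod card_option card_prod !card_ord card_bool muln2 mulnC.
apply/(step_orderP num_pos); exists (fill inflation f None).
split; last exact: inflated_fill_stepped.
exact: (fill_skein None (inflate_candelabra None FS hC) fS (stem_closed fS)).
Qed.

End InflatedPairs.

Theorem step_order_inflate_parallel (G : finZmodType) (posG : G -> nat)
    (h : ternary (candelabra_point 'I_1 G 'I_3)) m :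
  numbering posG -> odd #|G| -> candelabra h -> parallel_pairs h ->
  step_order m.*2.+2 -> step_order #|G|.+1 -> step_order (#|G| * m.*2.+1).+1.
Proof.
move=> numG oddG hC par.
have numW := numbering_option (numbering_lex numbering_bool (numbering_ord m)).
have -> : m.*2.+2 = #|{: option (option ('I_m * bool))}|.
  by rewrite !card_option card_prod card_ord card_bool muln2.
move=> /(step_orderP (numbering_option numW))[F [FS F_step]].
exact: (step_order_inflate_pairs numG hC par FS F_step oddG).
Qed.

(** * Tripling *)

(* One-factorizations of the complete graph on [Z_2n] in which no factor mixes edges with
   difference in [D] and edges with difference outside [D]. *)
Section CirculantOneFactorization.

Local Open Scope ring_scope.

Variable n : nat.
Let Z := 'I_n.*2.+2.
Implicit Types (x y z d s : Z) (c : Z + Z).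

Variable D : pred Z.
Hypotheses (D_odd : forall d, D d -> odd d) (D_opp : forall d, D (- d) = D d).
Hypothesis D_antipode : D (antipode n) = false.

Definition respects_differences (g : ternary Z) : Prop :=
  forall x y z, D (g x y z - z) = D (y - x).

Let even_notin_D d : ~~ odd d -> D d = false.
Proof. by move=> even_d; apply/negP => /D_odd; rewrite (negbTE even_d). Qed.

(* An edge with odd difference is oriented from its even end to its odd end. *)
Let rise x y : Z := if odd x then x - y else y - x.
Let move_by d z : Z := if odd z then z - d else z + d.

Let riseC x y : odd x != odd y -> rise x y = rise y x.
Proof. by rewrite /rise; case: (odd x); case: (odd y). Qed.

Let move_by_rise x y : move_by (rise x y) x = y.
Proof. by rewrite /move_by /rise; case: (odd x); ring. Qed.

Let rise_move_by d z : rise z (move_by d z) = d.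
Proof. by rewrite /move_by /rise; case: (odd z); ring. Qed.

Let odd_rise x y : odd (rise x y) = odd x (+) odd y.
Proof. by rewrite /rise; case ox: (odd x); rewrite odd_ordD odd_ordN ox //= addbF. Qed.

Let odd_move_by d z : odd (move_by d z) = odd d (+) odd z.
Proof. by rewrite /move_by; case oz: (odd z); rewrite odd_ordD ?odd_ordN oz addbC. Qed.

Let D_rise x y : D (rise x y) = D (y - x).
Proof. by rewrite /rise; case: ifP => // _; rewrite -D_opp opprB. Qed.

Section EvenHalf.

Variable g : ternary 'I_n.+1.
Hypothesis gO : one_factorization g.

Let halve x : 'I_n.+1 := inord x./2.
Let interleave (a : 'I_n.+1) (b : bool) : Z := inZp (a.*2 + b).

Let val_interleave a b : interleave a b = (a.*2 + b)%N :> nat.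
Proof. by rewrite /= modn_small //; have := ltn_ord a; case: b => /=; lia. Qed.

Let odd_interleave a b : odd (interleave a b) = b.
Proof. by rewrite val_interleave oddD odd_double oddb. Qed.

Let halve_interleave a b : halve (interleave a b) = a.
Proof.
by apply/ord_inj; rewrite /halve val_interleave addnC half_bit_double inordK.
Qed.

Let interleaveK x : interleave (halve x) (odd x) = x.
Proof.
apply/ord_inj; rewrite val_interleave inordK 1?addnC ?odd_double_half //.
by have := ltn_ord x; lia.
Qed.

Let partner x y z : Z :=
  if odd x == odd y then interleave (g (halve x) (halve y) (halve z)) (odd z)
  else move_by (rise x y) z.

Let partner_one_factorization : one_factorization partner.
Proof.
rewrite /partner; split=> [x y z|x y|x z|x y z t] /=.
- rewrite eq_sym; case: eqP => // /eqP xy; first by rewrite (ofacC gO).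
  by rewrite riseC // eq_sym.
- case: eqP => [xy|_]; last exact: move_by_rise.
  by rewrite (ofac_left gO) xy interleaveK.
- by rewrite eqxx (ofac_same gO) interleaveK.
- case: (altP (odd x =P odd y)) => [xy|xy].
    by rewrite odd_interleave eqxx halve_interleave (ofac_edge gO).
  rewrite odd_move_by odd_rise rise_move_by.
  by case: (odd x) (odd y) (odd z) xy => [] [] [].
Qed.

Let partner_respects : respects_differences partner.
Proof.
move=> x y z; rewrite /partner; case: (altP (odd x =P odd y)) => [xy|xy].
  by rewrite !even_notin_D // odd_ordD odd_ordN ?odd_interleave ?xy addbb.
by rewrite -D_rise rise_move_by D_rise.
Qed.

Lemma circulant_one_factorization_even :
  exists2 g : ternary Z, one_factorization g & respects_differences g.
Proof. exact: (ex_intro2 _ _ partner partner_one_factorization partner_respects). Qed.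

End EvenHalf.

Section OddHalf.

Hypothesis half_odd : odd n.+1.

Let odd_antipode : odd (antipode n). Proof. by rewrite val_antipode half_odd. Qed.

(* The edges with even difference, together with those joining antipodes, are coloured by
   their sum, which is made even by replacing [x + antipode] by [x]; the other edges are
   coloured by their rise. *)
Let flat_edge x y : bool := ~~ odd (y - x)%R || (y - x == antipode n).
Let even_sum x y : Z := if y - x == antipode n then x + x else x + y.
Let colour x y : Z + Z := if flat_edge x y then inl (even_sum x y) else inr (rise x y).
Let partner c z : Z :=
  match c with
  | inl s => if s - z == z then z + antipode n else s - z
  | inr d => move_by d z
  end.
Let D_colour c : bool := if c is inr d then D d else false.

Let antipodal_sym x y : (y - x == antipode n) = (x - y == antipode n).
Proof. by apply/eqP/eqP => e; rewrite -opprB e antipodeN. Qed.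

Let colourC x y : x != y -> colour x y = colour y x.
Proof.
move=> _; rewrite /colour; have -> : flat_edge y x = flat_edge x y.
  by rewrite /flat_edge antipodal_sym -[x - y]opprB odd_ordN.
case: ifP => [_|/negbT]; last first.
  rewrite negb_or negbK odd_ordD odd_ordN => /andP[xy _].
  by rewrite riseC //; move: xy; case: (odd x); case: (odd y).
congr inl; rewrite /even_sum antipodal_sym; case: eqP => [xy|_]; last exact: addrC.
by rewrite -[x](subrK y) xy addrACA antipodeD add0r.
Qed.

Let partner_colour x y : x != y -> partner (colour x y) x = y.
Proof.
move=> xy; rewrite /partner /colour; case: ifP => _; last exact: move_by_rise.
rewrite /even_sum; case: (y - x =P antipode n) => [<-|_].
  by rewrite (addrK x x) eqxx addrC subrK.
by rewrite [x + y]addrC (addrK x y) eq_sym (negbTE xy).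
Qed.

Let odd_even_sum x y : flat_edge x y -> ~~ odd (even_sum x y).
Proof.
rewrite /flat_edge /even_sum; case: eqP => [_ _|_]; first by rewrite odd_ordD addbb.
by rewrite orbF !odd_ordD odd_ordN addbC.
Qed.

Let flat_partner s z : ~~ odd s -> z != partner (inl s) z /\ colour z (partner (inl s) z) = inl s.
Proof.
move=> even_s; have even_gap : ~~ odd (s - z - z)%R by rewrite !odd_ordD odd_ordN addbK.
rewrite /partner /colour /flat_edge /even_sum; case: (s - z =P z) => sz.
  have -> : z + antipode n - z = antipode n by ring.
  rewrite eqxx orbT; split; last by rewrite -{1}sz subrK.
  rewrite -{1}[z]addr0 (inj_eq (addrI z)); apply/eqP => anti0.
  by move: odd_antipode; rewrite -anti0.
rewrite even_gap; split; first by rewrite eq_sym; apply/eqP.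
have /negbTE-> : s - z - z != antipode n.
  by apply: contraNneq even_gap => ->.
by congr inl; ring.
Qed.

Let steep_partner d z : odd d -> d != antipode n ->
  z != partner (inr d) z /\ colour z (partner (inr d) z) = inr d.
Proof.
move=> odd_d d_anti; rewrite /colour /partner rise_move_by; split.
  by apply/eqP => e; move: (odd_move_by d z); rewrite -e odd_d; case: (odd z).
rewrite /flat_edge odd_ordD odd_ordN odd_move_by odd_d.
rewrite /move_by; case oz: (odd z) => /=; last by rewrite addrC addKr (negbTE d_anti).
by rewrite addrC addKr -[antipode n]antipodeN (inj_eq oppr_inj) (negbTE d_anti).
Qed.

Let colour_partner x y z : x != y ->
  z != partner (colour x y) z /\ colour z (partner (colour x y) z) = colour x y.
Proof.
move=> _; case xy: (flat_edge x y).
  by rewrite [colour x y]/colour xy; apply/flat_partner/odd_even_sum.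
rewrite [colour x y]/colour xy; move/negbT: xy; rewrite negb_or negbK => /andP[odd_yx yx].
apply: steep_partner; first by rewrite odd_rise -odd_ordN -odd_ordD addrC.
by rewrite /rise; case: ifP => // _; rewrite -antipodal_sym.
Qed.

Let D_colourE x y : D (y - x) = D_colour (colour x y).
Proof.
rewrite /colour; case: ifP => [/orP[/even_notin_D-> //|/eqP->]|_].
  exact: D_antipode.
exact/esym/D_rise.
Qed.

Lemma circulant_one_factorization_odd :
  exists2 g : ternary Z, one_factorization g & respects_differences g.
Proof.
exists (colouring_partner colour partner); first exact: colouring_one_factorization.
move=> x y z; rewrite /colouring_partner; case: (altP (x =P y)) => [->|xy]; first by rewrite !subrr.
by have [_ e] := colour_partner z xy; rewrite !D_colourE e.
Qed.

End OddHalf.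

Lemma circulant_one_factorization :
  exists2 g : ternary Z, one_factorization g & respects_differences g.
Proof.
case: (boolP (odd n.+1)) => [|even_half]; first exact: circulant_one_factorization_odd.
have [g gO] : exists g : ternary 'I_n.+1, one_factorization g.
  by apply: one_factorization_exists; rewrite card_ord.
exact: (circulant_one_factorization_even gO).
Qed.

End CirculantOneFactorization.

Section Tripling.

Local Open Scope ring_scope.

Variables (S : eqType) (Z : comNzRingType).
Implicit Types (i j m : 'I_3) (x y z d : Z) (s : S) (p q r : 'I_3 * Z).

(* A transversal triple with sum [d] is completed by a stem point if [d] is one of the
   [stem_sum s]; otherwise [d] belongs to a class [i], and the point in group [i] is
   moved so that the sum becomes [centre i - d]. [base i] recovers [d] from the move. *)
Variables (stem_sum : S -> Z) (class : Z -> S + 'I_3) (centre : 'I_3 -> Z).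
Variables (is_move : pred Z) (base : 'I_3 -> Z -> Z) (g : ternary Z).
Hypothesis class_stem_sum : forall s, class (stem_sum s) = inl s.
Hypothesis stem_sum_class : forall d s, class d = inl s -> stem_sum s = d.
Hypothesis class_reflect : forall d i, class d = inr i ->
  [/\ class (centre i - d) = inr i, is_move (centre i - d - d) & base i (centre i - d - d) = d].
Hypothesis baseP : forall i d, is_move d ->
  class (base i d) = inr i /\ centre i - base i d - base i d = d.
Hypotheses (is_move0 : is_move 0 = false) (gO : one_factorization g).
Hypothesis move_g : forall x y z, is_move (g x y z - z) = is_move (y - x).

Let base_opp i d : is_move d -> is_move (- d) /\ base i (- d) = base i d + d.
Proof.
move=> d_move; have [class_base base_d] := baseP i d_move.
have [class_refl _ _] := class_reflect class_base.
have [_ opp_move base_opp_d] := class_reflect class_refl.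
have oppE : centre i - (centre i - base i d) - (centre i - base i d) = - d.
  by rewrite -[in RHS]base_d; ring.
rewrite oppE in opp_move base_opp_d; split=> //.
by rewrite base_opp_d -[in X in _ = _ + X]base_d; ring.
Qed.

Let is_moveN d : is_move (- d) = is_move d.
Proof. by apply/idP/idP => [|/(base_opp 0)[] //]; move/(base_opp 0) => []; rewrite opprK. Qed.

Let other i j : 'I_3 := - i - j.

Let triple_stem s p q : candelabra_point S Z 'I_3 :=
  inr (other p.1 q.1, stem_sum s - p.2 - q.2).

Let triple_aligned i x y r : candelabra_point S Z 'I_3 :=
  if is_move (y - x) then inr (other i r.1, base i (y - x) - x - r.2) else inr (r.1, g x y r.2).

Let triple_transversal p q r : candelabra_point S Z 'I_3 :=
  let d := p.2 + q.2 + r.2 in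
  match class d with
  | inl s => inl s
  | inr m => inr (m, (if m == p.1 then p.2 else if m == q.1 then q.2 else r.2)
                     + (centre m - d - d))
  end.

Definition tripling : ternary (candelabra_point S Z 'I_3) :=
  assemble triple_stem triple_aligned triple_transversal.

Arguments tripling : simpl never.

Let distinct3 i j m k : i != j -> i != m -> j != m -> [|| k == i, k == j | k == m].
Proof.
by move: i j m k; do 4![case=> [[|[|[|?]]] ?] //].
Qed.

Let otherP i j m : i != j -> i != m -> j != m -> other i j = m.
Proof.
by move: i j m; do 3![case=> [[|[|[|?]]] ?] //] => _ _ _; apply/val_inj.
Qed.

Let other_neq i j : i != j -> i != other i j /\ j != other i j.
Proof. by move: i j; do 2![case=> [[|[|[|?]]] ?] //]. Qed.

Let triple_stemC s p q : p.1 != q.1 -> triple_stem s p q = triple_stem s q p.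
Proof. by move=> _; rewrite /triple_stem /other addrAC [- p.1 - _]addrC. Qed.

Let triple_alignedC i x y r : i != r.1 -> triple_aligned i x y r = triple_aligned i y x r.
Proof.
move=> _; rewrite /triple_aligned -is_moveN opprB; case: ifP => xy; last by rewrite (ofacC gO).
have [_ ] := base_opp i xy; rewrite opprB => ->.
by congr (inr (_, _)); ring.
Qed.

Let triple_transversalC12 p q r : in_distinct_groups p q r ->
  triple_transversal p q r = triple_transversal q p r.
Proof.
case/and3P=> pq _ _; rewrite /triple_transversal [q.2 + p.2]addrC.
by case: (class _) => // m; case: (altP (m =P p.1)) => [->|//]; rewrite (negbTE pq).
Qed.

Let triple_transversalC23 p q r : in_distinct_groups p q r ->
  triple_transversal p q r = triple_transversal p r q.
Proof.
case/and3P=> pq pr qr; rewrite /triple_transversal [p.2 + r.2 + q.2]addrAC.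
case: (class _) => // m; case: (altP (m =P p.1)) => // mp.
case: (altP (m =P q.1)) => [->|mq]; first by rewrite (negbTE qr).
by have := distinct3 m pq pr qr; rewrite (negbTE mp) (negbTE mq) /= => ->.
Qed.

Let triplingC12 a b c : crossing a b c -> tripling a b c = tripling b a c.
Proof. exact: (assembleC12 triple_stemC triple_alignedC triple_transversalC12). Qed.

Let triple_transversalE p q r : in_distinct_groups p q r ->
  tripling (inr p) (inr q) (inr r) = triple_transversal p q r.
Proof. by case/and3P=> pq pr qr; rewrite /tripling /= (negbTE pq) (negbTE pr) (negbTE qr). Qed.

Let triple_stemK s p q : p.1 != q.1 ->
  tripling (inr p) (inr q) (triple_stem s p q) = inl s.
Proof.
move=> pq; have [po qo] := other_neq pq.
rewrite triple_transversalE /in_distinct_groups ?pq ?po //.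
by rewrite /triple_transversal /= (_ : _ + _ = stem_sum s) ?class_stem_sum //; ring.
Qed.

Let triple_alignedK p z q : p.1 != q.1 ->
  tripling (inr p) (inr q) (triple_aligned p.1 p.2 z q) = inr (p.1, z).
Proof.
case: p q => [i x] [j y] /= ij; have [io jo] := other_neq ij.
rewrite /triple_aligned /=; case: ifP => zx; last first.
  by rewrite /tripling /= (negbTE ij) eqxx /triple_aligned move_g zx (ofac_edge gO) (ofac_left gO).
rewrite triple_transversalE /in_distinct_groups /= ?ij ?io //.
rewrite /triple_transversal /= (_ : x + y + _ = base i (z - x)); last by ring.
by have [-> ->] := baseP i zx; rewrite eqxx addrC subrK.
Qed.

Let triple_transversalK p q r : in_distinct_groups p q r ->
  tripling (inr p) (inr q) (triple_transversal p q r) = inr r.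
Proof.
move=> pqr; have := pqr; case/and3P: (pqr).
case: p q r pqr => [i x] [j y] [k z] pqr /= ij ik jk _.
rewrite {1}/triple_transversal /=; set d := x + y + z.
have zE : d - x - y = z by rewrite /d; ring.
case class_d: (class d) => [s|m].
  by rewrite /tripling /= /triple_stem /= (otherP ij ik jk) (stem_sum_class class_d) zE.
have [class_refl move_d base_d] := class_reflect class_d.
have addKl u : u + (centre m - d - d) - u = centre m - d - d by ring.
case: (altP (m =P i)) => [mi|mi].
  subst m; rewrite /tripling /= (negbTE ij) eqxx /triple_aligned addKl move_d base_d.
  by rewrite zE /= (otherP ij ik jk).
case: (altP (m =P j)) => [mj|mj].
  subst m; rewrite triplingC12 ?crossing_apart12 // /tripling /= eq_sym (negbTE ij) eqxx.
  by rewrite /triple_aligned addKl move_d base_d addrAC zE /= (otherP _ jk ik) // eq_sym.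
have mk : m = k by have := distinct3 m ij ik jk; rewrite (negbTE mi) (negbTE mj) => /eqP.
rewrite mk in class_refl *; rewrite triple_transversalE // /triple_transversal /=.
rewrite (_ : x + y + _ = centre k - d); last by rewrite /d; ring.
rewrite class_refl eq_sym (negbTE ik) eq_sym (negbTE jk); congr (inr (_, _)); ring.
Qed.

Lemma tripling_candelabra : candelabra tripling.
Proof.
apply: (assemble_candelabra triple_stemC triple_alignedC triple_transversalC12
  triple_transversalC23 _ triple_stemK triple_alignedK triple_transversalK).
- by move=> i x r _; rewrite /triple_aligned subrr is_move0 (ofac_same gO) -surjective_pairing.
- by move=> s p q /other_neq[].
- by move=> i x y r ir; rewrite /triple_aligned; case: ifP => _ //=; have [] := other_neq ir.
Qed.

Lemma tripling_flat (posZ : Z -> nat) :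
  (forall x y, step_pair posZ x y -> is_move (y - x) = false) -> flat_pairs posZ tripling.
Proof.
move=> flat i j x y z ij xy; exists (g x y z).
by rewrite /tripling /= eqxx /triple_aligned (flat _ _ xy).
Qed.

End Tripling.

(* The sums below [6 r] are cut into three intervals of length [2 r], one for each group,
   and [d] is reflected within its interval; the remaining sums belong to the stem. *)
Section IntervalTripling.

Variables (r t n : nat).
Hypotheses (r_gt0 : 0 < r) (order_eq : n.*2.+2 = 6 * r + t.+1).
Let Z := 'I_n.*2.+2.
Implicit Types (i : 'I_3) (d : Z) (s : 'I_t.+1).

Let stem_sum s : Z := inZp (6 * r + s).
Let class d : 'I_t.+1 + 'I_3 :=
  if d < 6 * r then inr (inord (d %/ (2 * r))) else inl (inord (d - 6 * r)).
Let mirror i : nat := 4 * r * i + 2 * r - 1.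
Let centre i : Z := inZp (mirror i).
Let is_move d : bool := odd d && ((d < 2 * r) || (n.*2.+2 - 2 * r < d)).
Let base i d : Z :=
  inZp (if d < 2 * r then (mirror i - d)./2 else (mirror i + (n.*2.+2 - d))./2).

Let val_inZp m : m < n.*2.+2 -> (inZp m : Z) = m :> nat.
Proof. by move=> m_lt; rewrite /= modn_small. Qed.

Let ord3P i : [\/ nat_of_ord i = 0, nat_of_ord i = 1 | nat_of_ord i = 2].
Proof. by case: i => [[|[|[|]]] lt] //; [constructor 1 | constructor 2 | constructor 3]. Qed.

Let classP d i : class d = inr i <-> 2 * r * i <= d < 2 * r * i + 2 * r.
Proof.
have r2 : 0 < 2 * r by rewrite muln_gt0.
have divP : (2 * r * i <= d < 2 * r * i + 2 * r) = (d %/ (2 * r) == i).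
  rewrite [2 * r * i]mulnC [_ + 2 * r]addnC -mulSn -leq_divRL // -ltn_divLR // ltnS.
  by rewrite andbC -eqn_leq.
have ltd : (d < 6 * r) = (d %/ (2 * r) < 3) by rewrite ltn_divLR // mulnA.
rewrite divP /class; case: ltnP => [d_lt|d_ge]; split=> //.
- by case=> <-; rewrite inordK // -ltd.
- by move/eqP=> dE; rewrite dE inord_val.
- by move/eqP=> dE; have := ltn_ord i; rewrite -dE -ltd ltnNge d_ge.
Qed.

Let val_reflect d i : class d = inr i -> (centre i - d)%R = mirror i - d :> nat.
Proof.
move/classP => d_in; have d_lt := ltn_ord d.
have [le_d lt_n] : d <= mirror i /\ mirror i - d < n.*2.+2.
  by rewrite /mirror; case: (ord3P i) d_in => -> d_in; lia.
by rewrite /centre -[in LHS](natr_Zp d) -Zp_nat -natrB // Zp_nat val_inZp.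
Qed.

Let class_stem_sum s : class (stem_sum s) = inl s.
Proof.
have s_lt := ltn_ord s; have sE : stem_sum s = 6 * r + s :> nat by rewrite val_inZp //; lia.
by rewrite /class sE ltnNge leq_addr addKn inord_val.
Qed.

Let stem_sum_class d s : class d = inl s -> stem_sum s = d.
Proof.
rewrite /class; case: ltnP => // d_ge [<-]; apply/ord_inj.
by have d_lt := ltn_ord d; rewrite val_inZp ?inordK ?subnKC //; lia.
Qed.

Let class_reflect d i : class d = inr i ->
  [/\ class (centre i - d)%R = inr i, is_move (centre i - d - d)%R &
      base i (centre i - d - d)%R = d].
Proof.
move=> dI; have reflE := val_reflect dI; move/classP: dI => d_in; have d_lt := ltn_ord d.
have := val_ordB (centre i - d)%R d; rewrite reflE => moveE; split.
- by apply/classP; rewrite reflE /mirror; case: (ord3P i) d_in => -> d_in; lia.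
- rewrite /is_move moveE; move: {moveE} reflE => _; rewrite /mirror.
  by case: (ord3P i) d_in => -> d_in; case: ifP => ?; lia.
- move: (centre i - d - d)%R moveE => e; rewrite /mirror => moveE; apply/ord_inj.
  rewrite /base /mirror.
  by case: (ord3P i) d_in moveE => -> d_in; case: ifP => ? moveE;
     case: ifP => ?; rewrite val_inZp; lia.
Qed.

Let baseP i d : is_move d ->
  class (base i d) = inr i /\ (centre i - base i d - base i d)%R = d.
Proof.
case/andP=> odd_d d_out; have d_lt := ltn_ord d.
have baseE : base i d =
    (if d < 2 * r then (mirror i - d)./2 else (mirror i + (n.*2.+2 - d))./2) :> nat.
  by rewrite /base val_inZp // /mirror; case: (ord3P i) => ->; case: ifP => ?; lia.
have class_base : class (base i d) = inr i.
  by apply/classP; rewrite baseE /mirror; case: (ord3P i) => ->; case: ifP => ?; lia.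
split=> //; apply/ord_inj; rewrite val_ordB (val_reflect class_base) baseE /mirror.
by case: (ord3P i) => ->; case: (ltnP d (2 * r)) => ?; case: ifP => ?; lia.
Qed.

Let odd_move d : is_move d -> odd d. Proof. by case/andP. Qed.

Let is_moveN d : is_move (- d)%R = is_move d.
Proof.
have := val_ordB (0%R : Z) d; rewrite sub0r /is_move => ->; have d_lt := ltn_ord d.
by rewrite [nat_of_ord 0%R]/=; case: ifP => ?; lia.
Qed.

Let antipode_not_move : is_move (antipode n) = false.
Proof. by rewrite /is_move val_antipode; lia. Qed.

Lemma interval_tripling : exists2 h : ternary (candelabra_point 'I_t.+1 'I_n.*2.+2 'I_3),
  candelabra h & flat_pairs (@antipodal_pos n) h.
Proof.
have [g gO g_move] := circulant_one_factorization odd_move is_moveN antipode_not_move.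
exists (tripling stem_sum class centre is_move base g); first exact: tripling_candelabra.
by apply: tripling_flat => x y /step_pair_antipodal ->.
Qed.

End IntervalTripling.

(** * Systems checked by computation *)

Lemma all_iota_ord n (P : pred nat) : all P (iota 0 n) -> forall i : 'I_n, P i.
Proof. by move=> /allP Pn i; apply: Pn; rewrite mem_iota ltn_ord. Qed.

Definition check_step_order v (f : ternary nat) : bool :=
  all (fun a => all (fun b => all (fun c =>
    [&& f a b c == f b a c, f a b c == f a c b, f a b c < v, f a b (f a b c) == c,
        (a == b) ==> (f a b c == c) & step_pair id a b && (c < a) ==> (f a b c < a)])
    (iota 0 v)) (iota 0 v)) (iota 0 v).

Lemma check_step_orderP v f : check_step_order v.+1 f -> step_order v.+1.
Proof.
move=> check; have checked a b c := all_iota_ord (all_iota_ord (all_iota_ord check a) b) c.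
exists (fun a b c => inord (f a b c)); split.
  split=> [a b c|a b c|a b|a b c].
  - by have /and5P[/eqP->] := checked a b c.
  - by have /and5P[_ /eqP->] := checked a b c.
  - by have /and5P[_ _ _ _ /andP[+ _]] := checked a a b; rewrite eqxx => /eqP->; rewrite inord_val.
  - by have /and5P[_ _ lt /eqP fK _] := checked a b c; rewrite (inordK lt) fK inord_val.
move=> a b c ab ca; have /and5P[_ _ lt _ /andP[_ /implyP below]] := checked a b c.
by rewrite (inordK lt) below // ca andbT.
Qed.

Lemma step_order2 : step_order 2.
Proof. by apply: (@check_step_orderP _ (fun a b c => (a + b + c) %% 2)); vm_compute. Qed.

Lemma step_order4 : step_order 4.
Proof. exact: (step_order_double (isT : ~~ odd 2) step_order2). Qed.

(* Found by computer search; any two of the pairs [{2t, 2t+1}] form a block. *)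
Definition blocks14 : seq (seq nat) :=
  [:: [:: 0; 1; 2; 3]; [:: 0; 1; 4; 5]; [:: 0; 1; 6; 7]; [:: 0; 1; 8; 9]; [:: 0; 1; 10; 11];
    [:: 0; 1; 12; 13]; [:: 0; 2; 4; 11]; [:: 0; 2; 5; 12]; [:: 0; 2; 6; 9]; [:: 0; 2; 7; 10];
    [:: 0; 2; 8; 13]; [:: 0; 3; 4; 12]; [:: 0; 3; 5; 9]; [:: 0; 3; 6; 10]; [:: 0; 3; 7; 13];
    [:: 0; 3; 8; 11]; [:: 0; 4; 6; 13]; [:: 0; 4; 7; 8]; [:: 0; 4; 9; 10]; [:: 0; 5; 6; 8];
    [:: 0; 5; 7; 11]; [:: 0; 5; 10; 13]; [:: 0; 6; 11; 12]; [:: 0; 7; 9; 12]; [:: 0; 8; 10; 12];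
    [:: 0; 9; 11; 13]; [:: 1; 2; 4; 6]; [:: 1; 2; 5; 11]; [:: 1; 2; 7; 12]; [:: 1; 2; 8; 10];
    [:: 1; 2; 9; 13]; [:: 1; 3; 4; 8]; [:: 1; 3; 5; 7]; [:: 1; 3; 6; 9]; [:: 1; 3; 10; 13];
    [:: 1; 3; 11; 12]; [:: 1; 4; 7; 13]; [:: 1; 4; 9; 11]; [:: 1; 4; 10; 12]; [:: 1; 5; 6; 10];
    [:: 1; 5; 8; 13]; [:: 1; 5; 9; 12]; [:: 1; 6; 8; 12]; [:: 1; 6; 11; 13]; [:: 1; 7; 8; 11];
    [:: 1; 7; 9; 10]; [:: 2; 3; 4; 5]; [:: 2; 3; 6; 7]; [:: 2; 3; 8; 9]; [:: 2; 3; 10; 11];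
    [:: 2; 3; 12; 13]; [:: 2; 4; 7; 9]; [:: 2; 4; 8; 12]; [:: 2; 4; 10; 13]; [:: 2; 5; 6; 13];
    [:: 2; 5; 7; 8]; [:: 2; 5; 9; 10]; [:: 2; 6; 8; 11]; [:: 2; 6; 10; 12]; [:: 2; 7; 11; 13];
    [:: 2; 9; 11; 12]; [:: 3; 4; 6; 11]; [:: 3; 4; 7; 10]; [:: 3; 4; 9; 13]; [:: 3; 5; 6; 12];
    [:: 3; 5; 8; 10]; [:: 3; 5; 11; 13]; [:: 3; 6; 8; 13]; [:: 3; 7; 8; 12]; [:: 3; 7; 9; 11];
    [:: 3; 9; 10; 12]; [:: 4; 5; 6; 7]; [:: 4; 5; 8; 9]; [:: 4; 5; 10; 11]; [:: 4; 5; 12; 13];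
    [:: 4; 6; 8; 10]; [:: 4; 6; 9; 12]; [:: 4; 7; 11; 12]; [:: 4; 8; 11; 13]; [:: 5; 6; 9; 11];
    [:: 5; 7; 9; 13]; [:: 5; 7; 10; 12]; [:: 5; 8; 11; 12]; [:: 6; 7; 8; 9]; [:: 6; 7; 10; 11];
    [:: 6; 7; 12; 13]; [:: 6; 9; 10; 13]; [:: 7; 8; 10; 13]; [:: 8; 9; 10; 11]; [:: 8; 9; 12; 13];
    [:: 10; 11; 12; 13]].

Definition fourth14 (a b c : nat) : nat :=
  if a == b then c else if a == c then b else if b == c then a else
  sumn (nth [::] blocks14 (find (fun B => [&& a \in B, b \in B & c \in B]) blocks14))
    - (a + b + c).

Lemma step_order14 : step_order 14.
Proof. by apply: (@check_step_orderP _ fourth14); vm_compute. Qed.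

Theorem step_order_triple r s : (s == 2) || (s == 4) -> 0 < r ->
  step_order (6 * r + s + s) -> step_order (3 * (6 * r + s) + s).
Proof.
move=> s24 r_gt0; have [t st] : exists t, s = t.+1 by case: s s24 => // t _; exists t.
have [n order_eq] : exists n, n.*2.+2 = 6 * r + t.+1.
  by exists ((6 * r + t.+1)./2.-1); case/orP: s24; rewrite st => /eqP->; lia.
have [h hC flat] := interval_tripling r_gt0 order_eq.
have := step_order_inflate (n := 3) (numbering_ord t.+1) (numbering_antipodal n) _ _ isT hC flat
  step_order4.
rewrite !card_ord -st order_eq -st [s + _]addnC [s + 3 * _]addnC; apply=> //.
by move: s24; lia.
Qed.

(* Ordinals built by [inord] do not reduce, so candelabra systems to be checked by
   evaluation are given by functions on natural numbers. *)
Section ComputedCandelabra.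

Variables (s g w : nat).

Local Notation point := (candelabra_point 'I_s.+1 'I_g.+1 'I_w.+1).
Local Notation nat_point := (candelabra_point nat nat nat).

Definition val_point (a : point) : nat_point :=
  match a with inl l => inl (val l) | inr p => inr (val p.1, val p.2) end.

Definition inord_point (a : nat_point) : point :=
  match a with inl l => inl (inord l) | inr p => inr (inord p.1, inord p.2) end.

Definition nat_points : seq nat_point :=
  [seq inl l | l <- iota 0 s.+1] ++ [seq inr (i, x) | i <- iota 0 w.+1, x <- iota 0 g.+1].

Variable h : ternary nat_point.

Definition check_candelabra : bool :=
  all (fun a => all (fun b => all (fun c => crossing a b c ==>
    [&& h a b c == h b a c, h a b c == h a c b, h a b c \in nat_points,
        crossing a b (h a b c), h a b (h a b c) == c & (a == b) ==> (h a b c == c)])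
    nat_points) nat_points) nat_points.

Definition ord_candelabra (a b c : point) : point :=
  inord_point (h (val_point a) (val_point b) (val_point c)).

Lemma val_pointK : cancel val_point inord_point.
Proof. by case=> [l|[i x]] /=; rewrite !inord_val. Qed.

Lemma val_point_in (a : point) : val_point a \in nat_points.
Proof.
rewrite mem_cat; case: a => [l|[i x]]; apply/orP; [left|right].
  by apply/mapP; exists (val l); rewrite // mem_iota ltn_ord.
by apply/allpairsP; exists (val i, val x); rewrite !mem_iota !ltn_ord.
Qed.

Lemma inord_pointK : {in nat_points, cancel inord_point val_point}.
Proof.
move=> p; rewrite mem_cat => /orP[/mapP[l l_lt ->]|/allpairsP[[i x] [i_lt x_lt ->]]].
  by rewrite mem_iota in l_lt; rewrite /= inordK.
by rewrite !mem_iota in i_lt x_lt; rewrite /= !inordK.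
Qed.

Lemma crossing_val (a b c : point) :
  crossing (val_point a) (val_point b) (val_point c) = crossing a b c.
Proof. by case: a b c => [?|[? ?]] [?|[? ?]] [?|[? ?]]. Qed.

Lemma check_candelabraP : check_candelabra -> candelabra ord_candelabra.
Proof.
move=> /allP check.
have {check} checked a b c : crossing a b c ->
    let t := h (val_point a) (val_point b) (val_point c) in
    [/\ t = h (val_point b) (val_point a) (val_point c),
        t = h (val_point a) (val_point c) (val_point b),
        t \in nat_points /\ crossing (val_point a) (val_point b) t,
        h (val_point a) (val_point b) t = val_point c & a = b -> t = val_point c].
  rewrite -crossing_val => abc.
  have /allP/(_ _ (val_point_in b))/allP/(_ _ (val_point_in c)) := check _ (val_point_in a).
  rewrite abc => /and5P[/eqP tC12 /eqP tC23 t_in abt /andP[/eqP tK /implyP t_same]].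
  by split=> // ab; apply/eqP/t_same; rewrite ab.
rewrite /ord_candelabra; split=> [a b c abc|a b c abc|a b ab|a b c abc].
- by have [-> _ _ _ _] := checked _ _ _ abc.
- by have [_ -> _ _ _] := checked _ _ _ abc.
- have [_ _ _ _ ->] // := checked a a b (crossing_apart23 _ ab); exact: val_pointK.
- have [_ _ [t_in abt] tK _] := checked _ _ _ abc.
  by rewrite -crossing_val inord_pointK // tK val_pointK.
Qed.

End ComputedCandelabra.

Definition sorted_by_group (T : Type) (h : nat -> nat -> nat -> T) (p q r : nat * nat) : T :=
  let coord i := if p.1 == i then p.2 else if q.1 == i then q.2 else r.2 in
  h (coord 0) (coord 1) (coord 2).

(* Meaningful only when exactly two of the arguments agree mod 3. *)
Definition odd_one_out (x y z : nat) : nat :=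
  if y == z %[mod 3] then 0 else if x == z %[mod 3] then 1 else 2.

(* The one-factorization of K_6 on Z_5 plus the point 5. *)
Definition K6_partner (x y z : nat) : nat :=
  if x == y then z else
  let c := (if x == 5 then y + y else if y == 5 then x + x else x + y) %% 5 in
  if z == 5 then (c * 3) %% 5 else
  let w := (c + 5 - z) %% 5 in if w == z then 5 else w.

Definition aligned38 (i x y : nat) (r : nat * nat) : candelabra_point nat nat nat :=
  let (j, z) := r in
  let e := (y + 12 - x) %% 12 in
  let o := 3 - i - j in
  if ~~ odd e then inr (j, (K6_partner x./2 y./2 z./2).*2 + odd z) else
  if (e \in [:: 5; 7]) || (e \in [:: 3; 9]) && (x == z %[mod 3]) then
    let e' := if odd x then 12 - e else e in
    inr (j, (if odd z then z + 12 - e' else z + e') %% 12)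
  else if e \in [:: 1; 11] then
    inr (o, ((if e == 1 then 7 else 8) + i.*2 + 24 - x - z) %% 12)
  else inr (o, ((x + 12 - z) %% 3 + (if e == 3 then 0 else 3) + 24 - x - z) %% 12).

Definition transversal38 (x y z : nat) : candelabra_point nat nat nat :=
  let move i e := inr (i, (nth 0 [:: x; y; z] i + e) %% 12) in
  let d := (x + y + z) %% 12 in
  if d == 3 then inl 0 else if d == 6 then inl 1 else
  if d == 0 then move 2 11 else
  if 6 < d then move (d - 7)./2 (if odd d then 1 else 11)
  else move (odd_one_out x y z) (if d < 3 then 3 else 9).

Definition stem38 (l : nat) (p q : nat * nat) : candelabra_point nat nat nat :=
  inr (3 - p.1 - q.1, (3 + 3 * l + 24 - p.2 - q.2) %% 12).

(* A candelabra system with groups Z_12 and a stem of two points. The sums {7,8}, {9,10},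
   {11,0} move one fixed coordinate by 1; {1,4} and {2,5} move the coordinate that is
   alone in its class mod 3 by 3; the sums 3 and 6 belong to the stem. *)
Definition candelabra38 : ternary (candelabra_point nat nat nat) :=
  assemble stem38 aligned38 (sorted_by_group transversal38).

Lemma check_candelabra38 : check_candelabra 1 11 2 candelabra38.
Proof. by vm_compute. Qed.

Lemma candelabra38_flat :
  flat_pairs (@antipodal_pos 5) (@ord_candelabra 1 11 2 candelabra38).
Proof.
move=> i j x y z ij /step_pair_antipodal xy.
have even_gap : ~~ odd ((y + 12 - x) %% 12).
  have := val_ordD (y - x)%R x; rewrite subrK xy val_antipode => ->.
  by have := ltn_ord x; lia.
eexists; rewrite /ord_candelabra /candelabra38 /= eqxx even_gap /= inord_val; reflexivity.
Qed.

Theorem step_order_inflate12 n : 0 < n -> step_order n.+1 -> step_order (12 * n + 2).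
Proof.
move=> n_gt0 sn.
have := step_order_inflate (numbering_ord 2) (numbering_antipodal 5) _ _ n_gt0
  (check_candelabraP check_candelabra38) candelabra38_flat sn.
rewrite !card_ord => inflated; rewrite mulnC addnC; apply: inflated => //.
exact: step_order14.
Qed.

Definition aligned10 (i x y : nat) (r : nat * nat) : candelabra_point nat nat nat :=
  let (j, z) := r in
  if x == y then inr (j, z) else if z == x then inr (j, y) else if z == y then inr (j, x)
  else inr (3 - i - j, z).

Definition stem10 (_ : nat) (p q : nat * nat) : candelabra_point nat nat nat :=
  inr (3 - p.1 - q.1, (6 - p.2 - q.2) %% 3).

Definition transversal10 (x y z : nat) : candelabra_point nat nat nat :=
  if (x + y + z) %% 3 == 0 then inl 0 else
  let i := odd_one_out x y z in
  inr (i, (6 - nth 0 [:: x; y; x] i - nth 0 [:: y; z; z] i) %% 3).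

(* SQS(10) as a candelabra system with three groups Z_3 and a single stem point. *)
Definition candelabra10 : ternary (candelabra_point nat nat nat) :=
  assemble stem10 aligned10 (sorted_by_group transversal10).

Lemma check_candelabra10 : check_candelabra 0 2 2 candelabra10.
Proof. by vm_compute. Qed.

Lemma candelabra10_parallel : parallel_pairs (@ord_candelabra 0 2 2 candelabra10).
Proof.
move=> i j x y ij; rewrite /ord_candelabra /candelabra10 /=.
have /negbTE-> : nat_of_ord i != j := ij.
by rewrite !eqxx; case: (nat_of_ord x =P y) => [->|_]; rewrite /= !inord_val.
Qed.

Theorem step_order_inflate3 m : step_order m.*2.+2 -> step_order (3 * m.*2.+1 + 1).
Proof.
move=> sm.
have := step_order_inflate_parallel (numbering_ord 3) _ (check_candelabraP check_candelabra10)
  candelabra10_parallel sm.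
by rewrite addn1 card_ord; apply=> //; exact: step_order4.
Qed.

(** * Induction on the order *)

Lemma step_order_mod6 q : (q %% 6 = 2 \/ q %% 6 = 4) -> step_order q.
Proof.
elim/ltn_ind: q => q IH q6.
have IHv v : v < q -> (v %% 6 = 2 \/ v %% 6 = 4) -> step_order v by move=> *; apply: IH.
case: (q =P 2) => [->|q2]; first exact: step_order2.
case: (boolP (q %% 4 == 0)) => mult4.
  have -> : q = (q %/ 2).*2 by lia.
  by apply: step_order_double; last apply: IHv; lia.
case: (boolP ((q %% 24 == 2) || (q %% 24 == 10))) => mod24.
  have [n qn] : exists n, q = 4 * n.*2 + 2 by exists (q %/ 8); lia.
  by rewrite qn; apply: step_order_quadruple; last apply: IHv; lia.
case: (boolP ((q %% 72 == 22) || (q %% 72 == 46))) => mod72_22_46.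
  have [m qm] : exists m, q = 3 * m.*2.+1 + 1 by exists (q %/ 6); lia.
  by rewrite qm; apply: step_order_inflate3; apply: IHv; lia.
case: (boolP ((q %% 72 == 14) || (q %% 72 == 38))) => mod72_14_38.
  have [n qn] : exists n, q = 12 * n + 2 by exists (q %/ 12); lia.
  by rewrite qn; apply: step_order_inflate12; last apply: IHv; lia.
case: (boolP (q %% 72 == 62)) => mod72_62.
  have [r qr] : exists r, q = 3 * (6 * r + 2) + 2 by exists (q %/ 18); lia.
  by rewrite qr; apply: step_order_triple; last apply: IHv; lia.
have [r qr] : exists r, q = 3 * (6 * r + 4) + 4 by exists ((q - 16) %/ 18); lia.
by rewrite qr; apply: step_order_triple; last apply: IHv; lia.
Qed.

Theorem theorem3p3 (q : nat) :
  4 <= q -> (q %% 6 = 2 \/ q %% 6 = 4) ->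
  exists (S : {set {set 'I_q}}) (L : {perm 'I_q}),
    is_SQS S /\ step_property S L.
Proof.
move=> _ /step_order_mod6[f [fS f_step]]; exists (blocks f), 1%g.
by split; [exact: blocks_is_SQS | exact: blocks_step_property].
Qed.
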